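(* Let $G$ be a connected graph on $n$ vertices. If $F:[0,\infty)\to\mathbb R$ is admissible third-order convex, then $$\sum_{i=1}^n F(\lambda_i(L(G)))\ge \sum_{i=1}^n F(\lambda_i(L(P_n)))$$ and $$\sum_{i=1}^n F(\lambda_i(Q(G)))\ge \sum_{i=1}^n F(\lambda_i(Q(P_n))).$$
   Context: All graphs are finite, simple, undirected and unweighted. For a graph $G$, $A(G)$ is the adjacency matrix, $D(G)$ the diagonal matrix of vertex degrees, $L(G)=D(G)-A(G)$ the Laplacian matrix and $Q(G)=D(G)+A(G)$ the signless Laplacian matrix; both are real symmetric and positive semidefinite. For a real symmetric matrix $M$, $\lambda_1(M)\ge\lambda_2(M)\ge\cdots$ are its eigenvalues repeated with multiplicity. $P_n$ denotes the path on $n$ vertices ($P_1$ is a single vertex). A function $F:[0,\infty)\to\mathbb R$ is called admissible third-order convex if $F\in C^2([0,\infty))$, $F''$ is absolutely continuous on every compact subinterval of $[0,\infty)$, $F(0)=0$, $F'(0)\ge 0$, $F''(0)\ge 0$, and the almost-everywhere derivative $F'''$ of $F''$ satisfies $F'''(t)\ge 0$ for almost every $t>0$. (Derivatives at $0$ are one-sided.) *)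

(* Defs.v *)
From mathcomp Require Import all_boot all_order all_algebra.
From mathcomp Require Import all_classical all_reals all_analysis.
From mathcomp.real_closed Require Import polyrcf.

Set Implicit Arguments.
Unset Strict Implicit.
Unset Printing Implicit Defensive.

Import Order.TTheory GRing.Theory Num.Theory.
Import numFieldNormedType.Exports.

Local Open Scope classical_set_scope.
Local Open Scope ring_scope.

Record sgraph (n : nat) := SGraph {
  adj :> rel 'I_n;
  adj_sym : symmetric adj;
  adj_irr : irreflexive adj
}.

Definition connected_graph n (G : sgraph n) : Prop :=
  forall u v : 'I_n, connect G u v.

Definition degree n (G : sgraph n) (u : 'I_n) : nat := #|[set v | G u v]%SET|.

Definition path_adj n : rel 'I_n :=
  fun u v => (u.+1 == v :> nat) || (v.+1 == u :> nat).

Lemma path_adj_sym n : symmetric (@path_adj n).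
Proof. by move=> u v; rewrite /path_adj orbC. Qed.

Lemma path_adj_irr n : irreflexive (@path_adj n).
Proof. by move=> u; rewrite /path_adj orbb eqn_leq ltnn. Qed.

Definition path_graph n : sgraph n :=
  SGraph (@path_adj_sym n) (@path_adj_irr n).

Section GraphMatrices.
Variables (R : realType) (n : nat).

Definition adjacency_mx (G : sgraph n) : 'M[R]_n :=
  \matrix_(u, v) (G u v)%:R.

Definition degree_mx (G : sgraph n) : 'M[R]_n :=
  diag_mx (\row_u (degree G u)%:R).

Definition laplacian (G : sgraph n) : 'M[R]_n :=
  degree_mx G - adjacency_mx G.

Definition signless_laplacian (G : sgraph n) : 'M[R]_n :=
  degree_mx G + adjacency_mx G.

(* The real eigenvalues of M in nonincreasing order, each repeated according
   to its multiplicity as a root of the characteristic polynomial.  When M is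
   symmetric this sequence has length n. *)
Definition spectrum (M : 'M[R]_n) : seq R :=
  sort >=%R
    (flatten [seq nseq (mup x (char_poly M)) x | x <- rootsR (char_poly M)]).

(* Indices start at 0: [lambda M i] is the (i+1)-st largest eigenvalue. *)
Definition lambda (M : 'M[R]_n) (i : nat) : R := nth 0 (spectrum M) i.

End GraphMatrices.

(* Functions on [0, +oo[ are represented by functions on R, of which only the
   values on [0, +oo[ are ever used. *)
Section Admissible.
Variable R : realType.

(* The difference quotients are restricted to [0, +oo[, so that the derivative
   is one-sided at 0 and two-sided elsewhere. *)
Definition has_deriv_nneg (f f' : R -> R) : Prop :=
  forall x : R, 0 <= x ->
    (fun y => (f y - f x) / (y - x)) @ within [set y | 0 <= y] x^' --> f' x.

Definition abs_continuous (f : R -> R) (a b : R) : Prop :=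
  forall e : R, 0 < e -> exists2 d : R, 0 < d &
    forall s : seq (R * R),
      (forall p, p \in s -> [/\ a <= p.1, p.1 <= p.2 & p.2 <= b]) ->
      pairwise (fun p q => (p.2 <= q.1) || (q.2 <= p.1)) s ->
      \sum_(p <- s) (p.2 - p.1) < d ->
      \sum_(p <- s) `|f p.2 - f p.1| < e.

(* F1 and F2 are the first and second derivatives of F, which are determined
   by F on [0, +oo[. *)
Definition admissible (F : R -> R) : Prop :=
  exists F1 F2 : R -> R,
    [/\ has_deriv_nneg F F1,
        has_deriv_nneg F1 F2,
        {within [set x | 0 <= x], continuous F2},
        (forall a b : R, 0 <= a -> a <= b -> abs_continuous F2 a b) &
        [/\ F 0 = 0, 0 <= F1 0, 0 <= F2 0 &
            {ae lebesgue_measure, forall t : R,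
              0 < t -> derivable F2 t 1 /\ 0 <= (F2^`())%classic t}]].

End Admissible.

(* Main.v *)
Require Import Defs.
From mathcomp Require Import all_boot all_order all_algebra all_fingroup.
From mathcomp Require Import all_classical all_reals all_analysis.
From mathcomp.real_closed Require Import polyrcf complex.
From mathcomp Require Import ring lra zify.

Set Implicit Arguments.
Unset Strict Implicit.
Unset Printing Implicit Defensive.

Import Order.TTheory GRing.Theory Num.Theory.

Local Open Scope ring_scope.

(** Why the theorem holds.  Put [M = D + sg A] with [sg = -1] for the Laplacian
    and [sg = 1] for the signless Laplacian.  Since the third derivative of
    [F] is nonnegative, [F] is, up to a constant, a mixture with nonnegative
    weights of [t], [t ^ 2] and the ramps [max (t - s) 0 ^ 2].  On nonnegative
    numbers, [t ^ 2] is the ramp with [s = 0], and [t] is, up to constants, a limit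
    of multiples of ramps with [s] tending to minus infinity.  So it is enough to
    treat the ramps with an arbitrary real [s] ([admissible_sum_le]).

    For ramps the proof is an induction on the graph by deletion of an edge [uv].
    Deleting an edge subtracts a rank one positive matrix from [M], so that the
    eigenvalues [lam_i] before and [mu_i] after the deletion interlace and
    [sum_i F lam_i - sum_i F mu_i] is the integral of [F'] over the disjoint
    intervals [mu_i, lam_i].  Call this set of intervals the shift of the edge.
    As [F'] is nonnegative, an edge that lies on a cycle can simply be dropped.  A
    bridge splits the graph into two connected graphs with [a] and [b] vertices,
    which by induction are at least as expensive as the paths on [a] and [b]
    vertices; the path on [a + b] vertices splits in the same way.  What remains
    is to compare the shift of a bridge of the graph with that of an edge of the
    path.

    The first three moments of a shift are differences of traces of powers of
    [M], and for a bridge they depend on the degrees [d] and [e] of its ends only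
    ([bridge_moments]): length [2], first moment [d + e], second moment
    [d ^ 2 + d + e ^ 2 + e - 4 / 3].  Both shifts are compared with the fixed set
    [K], the union of [0, 1] and [3, 4].  The shift of an edge of the path has
    length [2], first moment at most [4] and lies in [0, 4]; among such sets [K]
    maximizes the integral of the convex nondecreasing function [F'], because it is
    the most spread out ([gain_le_threshold]).  A bridge of the graph with a shift that
    beats [K] exists as soon as some vertex has degree at least 3: if [d + e >= 6]
    the first moment is large enough ([gain_ge_threshold_mean6]); if [d + e = 5]
    is the largest value, the shift lies in [0, 5] and its second moment forces
    it to be spread out ([gain_ge_threshold_mean5]); if [d + e <= 4] for all
    edges, a vertex of degree at least 3 has degree 3 and a neighbour of degree 1,
    and the shift of this edge lies in [0, 4] and has the moments of [K] ([gain_ge_threshold_claw]).  A connected graph whose edges are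
    all bridges and whose degrees are at most 2 is the path itself
    ([iso_path_graph]).

    The moment comparisons are certified by quadratic polynomials [q]: the integral
    of [q - F'] over a shift is at most the total increase of a primitive of
    [q - F'] ([rise_le]), whereas the integral of [q] is known from the moments. *)

(** * Interlacing sequences and their moments *)

Section Interlacing.
Variable R : realFieldType.
Implicit Types (F G Q : R -> R) (x y : nat -> R) (a b c s t : R).

Definition gain F n x y : R := \sum_(i < n) (F (x i) - F (y i)).

(** The first [n] terms of [x] and [y] satisfy
    [b >= x_0 >= y_0 >= x_1 >= y_1 >= ... >= a].  The sequences are indexed by all
    natural numbers because this is how eigenvalues are numbered by [lambda]. *)
Definition interlaced n x y a b : Prop :=
  [/\ forall i, (i < n)%N -> a <= y i,
      forall i, (i < n)%N -> x i <= b,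
      forall i, (i < n)%N -> y i <= x i
    & forall i, (i.+1 < n)%N -> x i.+1 <= y i].

(** [V] bounds the positive variation of [G] on [a, b], in the form in which it
    is used: the increase of [G] over disjoint intervals. *)
Definition rise_le G a b (V : R) : Prop :=
  forall n x y, interlaced n x y a b -> gain G n x y <= V.

Definition nondecr_on G a b := forall u v, a <= u -> u <= v -> v <= b -> G u <= G v.

Lemma gainB F G n x y :
  gain (fun t => F t - G t) n x y = gain F n x y - gain G n x y.
Proof. by rewrite /gain -sumrB; apply: eq_bigr => i _; ring. Qed.

(** The intervals are disjoint and decreasing, so the increments telescope. *)
Lemma rise_nondecr G a b : a <= b -> nondecr_on G a b -> rise_le G a b (G b - G a).
Proof.
move=> leab Gm n x y [ya xb yx xy].
suff tel m : (m < n)%N ->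
    \sum_(i < m.+1) (G (x i) - G (y i)) <= G b - G (y m).
  case: n ya xb yx xy tel => [|n] ya xb yx xy tel.
    by rewrite /gain big_ord0 subr_ge0 Gm.
  apply: le_trans (tel n (ltnSn n)) _; rewrite lerB //; apply: Gm => //.
  - exact: ya.
  - by apply: le_trans (yx n _) (xb n _).
elim: m => [|m IH] ltmn.
  rewrite big_ord_recr big_ord0 /= add0r lerB //; apply: Gm => //.
  - by apply: le_trans (ya 0 _) (yx 0 _).
  - exact: xb.
rewrite big_ord_recr /=; have := IH (ltnW ltmn).
suff: G (x m.+1) <= G (y m) by lra.
apply: Gm; first by apply: le_trans (ya _ ltmn) (yx _ ltmn).
  exact: xy.
by apply: le_trans (yx m _) (xb m _); apply: ltnW.
Qed.

Lemma rise_nonincr G a b : nondecr_on (fun t => - G t) a b -> rise_le G a b 0.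
Proof.
move=> Gm n x y [ya xb yx xy]; apply: sumr_le0 => i _.
by have := Gm _ _ (ya i (ltn_ord i)) (yx i (ltn_ord i)) (xb i (ltn_ord i)); lra.
Qed.

(** Truncating both sequences above and below at [c] keeps them interlaced, and
    the increase of [G] over an interval is the sum of the two truncated ones. *)
Lemma rise_cat G a c b V W : a <= c -> c <= b ->
  rise_le G a c V -> rise_le G c b W -> rise_le G a b (V + W).
Proof.
move=> leac lecb GV GW n x y [ya xb yx xy].
pose lo (z : nat -> R) i := Num.min (z i) c.
pose hi (z : nat -> R) i := Num.max (z i) c.
have -> : gain G n x y = gain G n (lo x) (lo y) + gain G n (hi x) (hi y).
  rewrite /gain -big_split; apply: eq_bigr => i _; rewrite /lo /hi /=.
  by case: (leP (x i) c) => _; case: (leP (y i) c) => _; ring.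
have lo_mono u v : u <= v -> Num.min u c <= Num.min v c.
  by move=> uv; rewrite le_min !ge_min uv lexx orbT.
have hi_mono u v : u <= v -> Num.max u c <= Num.max v c.
  by move=> uv; rewrite ge_max !le_max uv lexx orbT.
apply: lerD; [apply: GV | apply: GW]; split=> i lti.
- by rewrite le_min (ya _ lti).
- by rewrite ge_min lexx orbT.
- exact/lo_mono/yx.
- exact/lo_mono/xy.
- by rewrite le_max lexx orbT.
- by rewrite ge_max (xb _ lti).
- exact/hi_mono/yx.
- exact/hi_mono/xy.
Qed.

Lemma rise_up_down_up G a b c d : a <= b -> b <= c -> c <= d ->
  nondecr_on G a b -> nondecr_on (fun t => - G t) b c -> nondecr_on G c d ->
  rise_le G a d (G b - G a + (G d - G c)).
Proof.
move=> ab bc cd Gab Gbc Gcd; rewrite -[G b - G a]addr0.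
have ac := le_trans ab bc.
apply: (rise_cat ac cd); last exact: rise_nondecr.
by apply: (rise_cat ab bc); [exact: rise_nondecr | exact: rise_nonincr].
Qed.

Lemma rise_down_up_down G a b c d : a <= b -> b <= c -> c <= d ->
  nondecr_on (fun t => - G t) a b -> nondecr_on G b c ->
  nondecr_on (fun t => - G t) c d -> rise_le G a d (G c - G b).
Proof.
move=> ab bc cd Gab Gbc Gcd; rewrite -[G c - G b]addr0 -[G c - G b]add0r.
have ac := le_trans ab bc.
apply: (rise_cat ac cd); last exact: rise_nonincr.
by apply: (rise_cat ab bc); [exact: rise_nonincr | exact: rise_nondecr].
Qed.

(** The increment of a cubic is recovered exactly from its derivative at the two
    end points and the midpoint, by Simpson's rule. *)
Lemma cubic_nondecr (A B C : R) a b :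
  (forall t, a <= t -> t <= b -> 0 <= A * 3 * t ^+ 2 + B * 2 * t + C) ->
  nondecr_on (fun t => A * t ^+ 3 + B * t ^+ 2 + C * t) a b.
Proof.
move=> dG u v au uv vb; rewrite -subr_ge0.
pose g t := A * 3 * t ^+ 2 + B * 2 * t + C.
have -> : A * v ^+ 3 + B * v ^+ 2 + C * v - (A * u ^+ 3 + B * u ^+ 2 + C * u)
  = (v - u) * (g u + 4 * g ((u + v) / 2) + g v) / 6 by rewrite /g; field.
have gu : 0 <= g u by apply: dG; lra.
have gv : 0 <= g v by apply: dG; lra.
have gm : 0 <= g ((u + v) / 2) by apply: dG; lra.
by apply: divr_ge0 => //; apply: mulr_ge0; lra.
Qed.

Definition ramp2 s t : R := Num.max (t - s) 0 ^+ 2.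

Lemma ramp2_low s t : t <= s -> ramp2 s t = 0.
Proof. by move=> ts; rewrite /ramp2 max_r ?expr0n ?subr_le0. Qed.

Lemma ramp2_high s t : s <= t -> ramp2 s t = (t - s) ^+ 2.
Proof. by move=> ts; rewrite /ramp2 max_l ?subr_ge0. Qed.

Lemma ramp2_nondecr s a b : nondecr_on (ramp2 s) a b.
Proof.
move=> u v _ uv _; rewrite /ramp2.
have uv' : Num.max (u - s) 0 <= Num.max (v - s) 0.
  by rewrite ge_max !le_max lexx orbT andbT lerB.
by apply: lerXn2r; rewrite // nnegrE le_max lexx orbT.
Qed.

(** The integral of the derivative of [ramp2 s] over the union of [0, 1] and
    [3, 4]. *)
Definition threshold s : R := ramp2 s 1 - ramp2 s 0 + (ramp2 s 4 - ramp2 s 3).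

Section Zones.
Variables (A B C s : R).
Let q t := 3 * A * t ^+ 2 + 2 * B * t + C.

(** A primitive of [q - ramp2' s], where [q] is the quadratic polynomial of a
    certificate. *)
Definition excess t := A * t ^+ 3 + B * t ^+ 2 + C * t - ramp2 s t.

Lemma excess_up_low a b : b <= s -> (forall t, a <= t -> t <= b -> 0 <= q t) ->
  nondecr_on excess a b.
Proof.
move=> bs qp u v au uv vb; rewrite /excess !ramp2_low; try lra.
rewrite !subr0; apply: (cubic_nondecr _ au uv vb) => t a_t tb.
by have := qp t a_t tb; rewrite /q; lra.
Qed.

Lemma excess_up_high a b : s <= a ->
  (forall t, a <= t -> t <= b -> 2 * (t - s) <= q t) -> nondecr_on excess a b.
Proof.
move=> sa qp u v au uv vb; rewrite /excess !ramp2_high; try lra.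
have := @cubic_nondecr A (B - 1) (C + 2 * s) a b _ u v au uv vb; rewrite /=.
suff P t : a <= t -> t <= b -> 0 <= A * 3 * t ^+ 2 + (B - 1) * 2 * t + (C + 2 * s).
  by move=> /(_ P); lra.
by move=> a_t tb; have := qp t a_t tb; rewrite /q; lra.
Qed.

Lemma excess_down_low a b : b <= s -> (forall t, a <= t -> t <= b -> q t <= 0) ->
  nondecr_on (fun t => - excess t) a b.
Proof.
move=> bs qn u v au uv vb; rewrite /excess !ramp2_low; try lra.
have := @cubic_nondecr (- A) (- B) (- C) a b _ u v au uv vb; rewrite /=.
suff P t : a <= t -> t <= b -> 0 <= - A * 3 * t ^+ 2 + - B * 2 * t - C.
  by move=> /(_ P); lra.
by move=> a_t tb; have := qn t a_t tb; rewrite /q; lra.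
Qed.

Lemma excess_down_high a b : s <= a ->
  (forall t, a <= t -> t <= b -> q t <= 2 * (t - s)) ->
  nondecr_on (fun t => - excess t) a b.
Proof.
move=> sa qn u v au uv vb; rewrite /excess !ramp2_high; try lra.
have := @cubic_nondecr (- A) (1 - B) (- C - 2 * s) a b _ u v au uv vb; rewrite /=.
suff P t : a <= t -> t <= b -> 0 <= - A * 3 * t ^+ 2 + (1 - B) * 2 * t + (- C - 2 * s).
  by move=> /(_ P); lra.
by move=> a_t tb; have := qn t a_t tb; rewrite /q; lra.
Qed.

End Zones.

(** The integrals of [1], [t] and [t ^ 2] over the union of the intervals
    [y_i, x_i] are [2], [m1] and [m2]. *)
Definition moments n x y (m1 m2 : R) : Prop :=
  [/\ gain id n x y = 2, gain (fun t => t ^+ 2) n x y = 2 * m1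
    & gain (fun t => t ^+ 3) n x y = 3 * m2].

Lemma gain_excess A B C s n x y m1 m2 : moments n x y m1 m2 ->
  gain (excess A B C s) n x y =
  3 * A * m2 + 2 * B * m1 + 2 * C - gain (ramp2 s) n x y.
Proof.
case=> g1 g2 g3; rewrite gainB; congr (_ - _).
have -> : gain (fun t => A * t ^+ 3 + B * t ^+ 2 + C * t) n x y =
   A * gain (fun t => t ^+ 3) n x y + B * gain (fun t => t ^+ 2) n x y + C * gain id n x y.
  by rewrite /gain !mulr_sumr -!big_split; apply: eq_bigr => i _ /=; ring.
by rewrite g1 g2 g3; ring.
Qed.

Lemma nondecr_cat F a b c : a <= c -> c <= b ->
  nondecr_on F a c -> nondecr_on F c b -> nondecr_on F a b.
Proof.
move=> ac cb Fl Fr u v au uv vb.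
have [vc|cv] := leP v c; first exact: Fl.
have [uc|cu] := leP u c; last by apply: Fr => //; apply: ltW.
by apply: le_trans (Fl u c au uc (lexx c)) (Fr c v (lexx c) (ltW cv) vb).
Qed.

Lemma excess_up A B C s a b :
  (forall t, a <= t -> t <= b -> 0 <= 3 * A * t ^+ 2 + 2 * B * t + C /\
     2 * (t - s) <= 3 * A * t ^+ 2 + 2 * B * t + C) ->
  nondecr_on (excess A B C s) a b.
Proof.
move=> qP.
have [bs|sb] := leP b s; first by apply: excess_up_low => // t *; case: (qP t).
have [sa|as_] := leP s a; first by apply: excess_up_high => // t *; case: (qP t).
apply: (@nondecr_cat _ _ _ s); try exact: ltW.
  by apply: excess_up_low => // t ta ts; case: (qP t) => //; lra.
by apply: excess_up_high => // t ta ts; case: (qP t) => //; lra.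
Qed.

Lemma excess_down A B C s a b :
  (forall t, a <= t -> t <= b ->
    (t <= s -> 3 * A * t ^+ 2 + 2 * B * t + C <= 0) /\
    (s <= t -> 3 * A * t ^+ 2 + 2 * B * t + C <= 2 * (t - s))) ->
  nondecr_on (fun t => - excess A B C s t) a b.
Proof.
move=> qP.
have [bs|sb] := leP b s.
  by apply: excess_down_low => // t ta tb; case: (qP t ta tb) => + _; apply; lra.
have [sa|as_] := leP s a.
  by apply: excess_down_high => // t ta tb; case: (qP t ta tb) => _; apply; lra.
apply: (@nondecr_cat _ _ _ s); try exact: ltW.
  apply: excess_down_low => // t ta ts; have [||+ _] := qP t; try lra; by apply.
by apply: excess_down_high => // t ta ts; have [||_] := qP t; try lra; apply.
Qed.

Lemma gain_ge0 n x y a b s : interlaced n x y a b -> 0 <= gain (ramp2 s) n x y.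
Proof.
case=> _ _ yx _; apply: sumr_ge0 => i _; rewrite subr_ge0.
by apply: (@ramp2_nondecr s (y i) (x i)) => //; exact: yx.
Qed.

(** [ramps] evaluates every ramp whose position relative to the kink follows from
    the context; [pos X Y] records that a product of nonnegative factors is
    nonnegative, which is what the linear solver lacks in the certificates. *)
Ltac ramps := rewrite /threshold; repeat match goal with |- context [ramp2 ?s ?t] =>
  first [ have -> : ramp2 s t = 0 by apply: ramp2_low; lra
        | have -> : ramp2 s t = (t - s) ^+ 2 by apply: ramp2_high; lra ] end.
Ltac pos X Y := have ? : 0 <= X * Y by apply: mulr_ge0; lra.

(** The chord of [ramp2' s] through the points [1] and [3] lies below the function
    outside [1, 3] and above it inside, because [ramp2' s] is convex.  Hence among
    all subsets of [0, 4] the union of [0, 1] and [3, 4] maximizes the integral of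
    the difference, and the integral of the chord, whose slope [2 * B] is
    nonnegative, is largest when [m1 = 4]. *)
Lemma gain_le_threshold n x y m1 m2 s : interlaced n x y 0 4 -> moments n x y m1 m2 ->
  m1 <= 4 -> gain (ramp2 s) n x y <= threshold s.
Proof.
move=> xy mom m14.
have [B [C [B0 up1 down up2]]] : exists B C : R,
  [/\ 0 <= B, nondecr_on (fun t => - excess 0 B C s t) 0 1,
     nondecr_on (excess 0 B C s) 1 3 & nondecr_on (fun t => - excess 0 B C s t) 3 4].
  have [s1|s1] := leP s 1; last have [s3|s3] := leP s 3.
  - exists 1, (- (2 * s)); split; rewrite ?ler01 //.
    + by apply: excess_down => t t0 t1; split; lra.
    + by apply: excess_up => t t0 t1; split; lra.
    + by apply: excess_down => t t0 t1; split; lra.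
  - exists ((3 - s) / 2), (- (3 - s)); split; rewrite ?divr_ge0 ?subr_ge0 //.
    + by apply: excess_down => t t0 t1; pos (3 - s) (1 - t); split; lra.
    + by apply: excess_up => t t0 t1; pos (3 - s) (t - 1); pos (3 - t) (s - 1); split; lra.
    + apply: excess_down => t t0 t1; split=> ts; last by pos (t - 3) (s - 1); lra.
      by pos (s - 3) (t - 1); lra.
  - exists 0, 0; split; rewrite ?lexx //.
    + by apply: excess_down => t t0 t1; split; lra.
    + by apply: excess_up => t t0 t1; split; lra.
    + by apply: excess_down => t t0 t1; split; lra.
have down' : nondecr_on (fun t => - - excess 0 B C s t) 1 3.
  by move=> u v ? ? ?; rewrite !opprK; apply: down.
have [le01 le13 le34] : [/\ 0 <= 1 :> R, 1 <= 3 :> R & 3 <= 4 :> R] by split; lra.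
have := rise_up_down_up le01 le13 le34 up1 down' up2 xy.
have -> : gain (fun t => - excess 0 B C s t) n x y = - gain (excess 0 B C s) n x y.
  by rewrite /gain -sumrN; apply: eq_bigr => i _; ring.
rewrite (gain_excess _ _ _ _ mom) /excess /threshold.
by pos B (4 - m1); lra.
Qed.

Lemma gain_ge_of_rise A B C s n x y a b m1 m2 V :
  interlaced n x y a b -> moments n x y m1 m2 ->
  rise_le (excess A B C s) a b V ->
  3 * A * m2 + 2 * B * m1 + 2 * C - V <= gain (ramp2 s) n x y.
Proof.
by move=> xy mom /(_ _ _ _ xy); rewrite (gain_excess _ _ _ _ mom); lra.
Qed.

(** A set of length [2] with mean at least [3] dominates [2, 4]: compare with the
    chord of [ramp2' s] through [2] and [4].  And [2, 4] is obtained from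
    the union of [0, 1] and [3, 4] by moving [0, 1] up to [2, 3]. *)
Lemma gain_ge_threshold_mean6 n x y U m1 m2 s : interlaced n x y 0 U -> 4 <= U ->
  moments n x y m1 m2 -> 6 <= m1 -> threshold s <= gain (ramp2 s) n x y.
Proof.
move=> xy U4 mom m16.
have [B [C [B0 z1 z2 z3]]] : exists B C : R,
  [/\ 0 <= B, nondecr_on (fun t => - excess 0 B C s t) 0 2,
     nondecr_on (excess 0 B C s) 2 4 & nondecr_on (fun t => - excess 0 B C s t) 4 U].
  have [s1|s1] := leP s 2; last have [s3|s3] := leP s 4.
  - exists 1, (- (2 * s)); split; rewrite ?ler01 //.
    + by apply: excess_down => t t0 t1; split; lra.
    + by apply: excess_up => t t0 t1; split; lra.
    + by apply: excess_down => t t0 t1; split; lra.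
  - exists ((4 - s) / 2), (- (2 * (4 - s))); split.
    + by rewrite divr_ge0 ?subr_ge0.
    + by apply: excess_down => t t0 t1; pos (4 - s) (2 - t); split; lra.
    + by apply: excess_up => t t0 t1; pos (4 - s) (t - 2); pos (4 - t) (s - 2); split; lra.
    + apply: excess_down => t t0 t1; split=> ts; last by pos (t - 4) (s - 2); lra.
      by pos (s - 4) (t - 2); lra.
  - exists 0, 0; split; rewrite ?lexx //.
    + by apply: excess_down => t t0 t1; split; lra.
    + by apply: excess_up => t t0 t1; split; lra.
    + by apply: excess_down => t t0 t1; split; lra.
have [le02 le24] : 0 <= 2 :> R /\ 2 <= 4 :> R by split; lra.
have := gain_ge_of_rise xy mom (rise_down_up_down le02 le24 U4 z1 z2 z3).
rewrite /excess.
suff : threshold s <= ramp2 s 4 - ramp2 s 2 by pos B (m1 - 6); lra.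
rewrite /threshold; have [s0|s0] := leP s 0; first by ramps; lra.
have [s1|s1] := leP s 1; first by ramps; pos s (1 - s); lra.
have [s2|s2] := leP s 2; first by ramps; lra.
have [s3|s3] := leP s 3; first by ramps; pos (3 - s) (3 - s); lra.
by ramps; lra.
Qed.

(** For [s <= 1] the function [2 * (t - s)] is a sufficient minorant of [ramp2' s].
    For [1 <= s <= 3] the certificate is [q = t * (t + 1 - 6 * s / 5) / 3], which
    agrees with [ramp2' s] at [0] and [5] and exceeds it exactly on
    [6 * s / 5 - 1, 6 * s / 5]: with [sigma = s - 5 / 2] the resulting margin is
    [1 / 36 + sigma ^ 2 / 25].  For [3 <= s <= 4] it is
    [q = (4 - s) / 4 * t * (t - 2)], which agrees with [ramp2' s] at [4] and exceeds
    it exactly on [2, 4]; there the second moment [50 / 3] makes the bound equal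
    to the required [(4 - s) ^ 2]. *)
Lemma gain_ge_threshold_mean5 n x y m1 m2 s : interlaced n x y 0 5 ->
  moments n x y m1 m2 -> m1 = 5 -> 50 / 3 <= m2 -> threshold s <= gain (ramp2 s) n x y.
Proof.
move=> xy mom m15 m2P.
have [s4|s4] := leP 4 s; first by apply: le_trans (gain_ge0 s xy); ramps; lra.
have [s1|s1] := leP s 1.
  have z : nondecr_on (fun t => - excess 0 1 (- (2 * s)) s t) 0 5.
    by apply: excess_down => t t0 t1; split; lra.
  have := gain_ge_of_rise xy mom (rise_nonincr z); rewrite m15.
  by have [s0|s0] := leP s 0; ramps; [lra | pos s (1 - s); lra].
have [s3|s3] := leP s 3.
  pose A : R := 1 / 9; pose B := (1 - 6 * s / 5) / 6.
  have z1 : nondecr_on (fun t => - excess A B 0 s t) 0 (6 * s / 5 - 1).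
    apply: excess_down => t t0 t1; split; last lra.
    by rewrite /A /B => ts; pos t (6 * s / 5 - 1 - t); lra.
  have z2 : nondecr_on (excess A B 0 s) (6 * s / 5 - 1) (6 * s / 5).
    apply: excess_up => t t0 t1; rewrite /A /B.
    by pos t (t + 1 - 6 * s / 5); pos (5 - t) (6 * s / 5 - t); split; lra.
  have z3 : nondecr_on (fun t => - excess A B 0 s t) (6 * s / 5) 5.
    apply: excess_down => t t0 t1; split; first lra.
    by rewrite /A /B; pos (5 - t) (t - 6 * s / 5); lra.
  have [le1 le2 le3] : [/\ 0 <= 6 * s / 5 - 1, 6 * s / 5 - 1 <= 6 * s / 5 & 6 * s / 5 <= 5].
    by split; lra.
  have := gain_ge_of_rise xy mom (rise_down_up_down le1 le2 le3 z1 z2 z3).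
  rewrite m15 /excess.
  (* the margin is [1 / 36 + (s - 5 / 2) ^ 2 / 25] *)
  have : 0 <= (s - 5 / 2) ^+ 2 by exact: sqr_ge0.
  by ramps; rewrite /A /B; lra.
pose A := (4 - s) / 12; pose B := - ((4 - s) / 4).
have z1 : nondecr_on (fun t => - excess A B 0 s t) 0 2.
  apply: excess_down => t t0 t1; split; last lra.
  by pos t (2 - t); pos (4 - s) (t * (2 - t)); rewrite /A /B; lra.
have z2 : nondecr_on (excess A B 0 s) 2 4.
  apply: excess_up => t t0 t1; rewrite /A /B.
  pos t (t - 2); pos (4 - s) (t * (t - 2)); pos (4 - s) (4 - t).
  by pos (4 - t) (s / 2 - (4 - s) * t / 4); split; lra.
have z3 : nondecr_on (fun t => - excess A B 0 s t) 4 5.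
  apply: excess_down => t t0 t1; split; first lra.
  by pos (4 - s) (5 - t); pos (t - 4) (s / 2 - (4 - s) * t / 4); rewrite /A /B; lra.
have [le02 le24 le45] : [/\ 0 <= 2 :> R, 2 <= 4 :> R & 4 <= 5 :> R] by split; lra.
have := gain_ge_of_rise xy mom (rise_down_up_down le02 le24 le45 z1 z2 z3).
rewrite m15 /excess.
by pos (4 - s) (m2 - 50 / 3); ramps; rewrite /A /B; lra.
Qed.

(** A set in [0, 4] with the moments of the union of [0, 1] and [3, 4] is that set.
    In terms of certificates: the chord of [ramp2' s] through [1] and [3] plus the polynomial
    [(t - 1) * (t - 3)] exceeds [ramp2' s] exactly on the union of [0, 1] and [3, 4]. *)
Lemma gain_ge_threshold_claw n x y s : interlaced n x y 0 4 ->
  moments n x y 4 (38 / 3) -> threshold s <= gain (ramp2 s) n x y.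
Proof.
move=> xy mom.
have [A [B [C [z1 z2 z3]]]] : exists A B C : R,
  [/\ nondecr_on (excess A B C s) 0 1,
     nondecr_on (fun t => - excess A B C s t) 1 3 & nondecr_on (excess A B C s) 3 4].
  have [s1|s1] := leP s 1; last have [s3|s3] := leP s 3.
  - exists (1 / 3), (- 2 + 1), (3 - 2 * s); split.
    + apply: excess_up => t t0 t1; have := sqr_ge0 (t - 1).
      by pos (1 - t) (3 - t); split; lra.
    + apply: excess_down => t t0 t1; split=> ts; last by pos (t - 1) (3 - t); lra.
      by pos (t - 1) (1 - t); lra.
    + apply: excess_up => t t0 t1; have := sqr_ge0 (t - 1).
      by pos (t - 1) (t - 3); split; lra.
  - exists (1 / 3), (- 2 + (3 - s) / 2), (3 - (3 - s)); split.
    + by apply: excess_up => t t0 t1; pos (1 - t) (s - t); pos (s - t) (3 - t); split; lra.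
    + apply: excess_down => t t0 t1; split=> ts; first by pos (t - 1) (s - t); lra.
      by pos (t - s) (3 - t); lra.
    + by apply: excess_up => t t0 t1; pos (t - 1) (t - s); pos (t - s) (t - 3); split; lra.
  - exists (1 / 3), (- 2), 3; split.
    + by apply: excess_up => t t0 t1; pos (1 - t) (3 - t); split; lra.
    + by apply: excess_down => t t0 t1; split; pos (t - 1) (3 - t); lra.
    + apply: excess_up => t t0 t1; have := sqr_ge0 (t - 3).
      by pos (t - 1) (t - 3); split; lra.
have [le01 le13 le34] : [/\ 0 <= 1 :> R, 1 <= 3 :> R & 3 <= 4 :> R] by split; lra.
have := gain_ge_of_rise xy mom (rise_up_down_up le01 le13 le34 z1 z2 z3).
by rewrite /excess /threshold; lra.
Qed.

End Interlacing.

(** * Monotone functions on an interval *)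

Section Monotone.
Import numFieldNormedType.Exports.
Local Open Scope classical_set_scope.
Local Open Scope ring_scope.
Variable R : realType.
Implicit Types (f g : R -> R) (a b u v x y : R).

(** Cousin's lemma: an additive property of intervals that holds for all small
    intervals around each point holds for the whole interval. *)
Lemma interval_cousin (P : R -> R -> Prop) a b : a <= b ->
  (forall u v w, a <= u -> u <= v -> v <= w -> w <= b -> P u v -> P v w -> P u w) ->
  (forall x, a <= x -> x <= b -> exists2 d : R, 0 < d &
     forall u v, a <= u -> u <= x -> x <= v -> v <= b -> v - u < d -> P u v) ->
  P a b.
Proof.
move=> ab Pcat Ploc.
have Paa : P a a by have [d d0 Pd] := Ploc a (lexx a) ab; apply: Pd => //; rewrite subrr.
pose S := [set x | [/\ a <= x, x <= b & P a x]].
have Sa : S a by split.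
have Sub : ubound S b by move=> x [].
have hS : has_sup S by split; [exists a | exists b].
have [c [ac cb Sc adh]] : exists c, [/\ a <= c, c <= b, forall x, S x -> x <= c
    & forall d, 0 < d -> exists2 x, S x & c - d < x].
  exists (sup S); split.
  - by apply: ub_le_sup => //; exists b.
  - by apply: ge_sup => //; exists a.
  - by move=> x Sx; apply: ub_le_sup => //; exists b.
  - by move=> d d0; apply: sup_adherent.
have [d d0 Pd] := Ploc c ac cb.
have [x [ax xb Pax] xc] := adh d d0.
have xlec : x <= c by apply: Sc.
have Pac : P a c.
  by apply: (Pcat a x c) => //; apply: Pd => //; lra.
have [bc|cb'] := leP b c; first by have <- : c = b by apply/le_anti; rewrite cb bc.
pose y := Num.min b (c + d / 2).
have [yb cy yd] : [/\ y <= b, c < y & y - c < d].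
  by rewrite /y; case: (leP b (c + d / 2)) => ?; split; lra.
have Pay : P a y by apply: (Pcat a c y) => //; [exact: ltW | apply: Pd => //; exact: ltW].
have : y <= c by apply: Sc; split=> //; rewrite (le_trans ac) ?ltW.
by rewrite leNgt cy.
Qed.

(** One-sided at [0], like [has_deriv_nneg], but in a form that is closed under
    linear combinations without any manipulation of filters. *)
Definition slope_at f (l : R) x : Prop := forall e : R, 0 < e -> exists2 d : R, 0 < d &
  forall y, 0 <= y -> `|y - x| < d -> `|f y - f x - l * (y - x)| <= e * `|y - x|.

Lemma has_deriv_slope f (f' : R -> R) : has_deriv_nneg f f' ->
  forall x, 0 <= x -> slope_at f (f' x) x.
Proof.
move=> df x x0 e e0.
have /cvgrPdist_lt/(_ e e0) := df x x0.
rewrite near_withinE /dnbhs near_withinE => /nbhs_ballP[d /= d0 Hd].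
exists d => // y y0 yd.
have [->|yx] := eqVneq y x; first by rewrite !subrr mulr0 subrr normr0 mulr0.
have := Hd y; rewrite /ball /= distrC => /(_ yd yx y0) /ltW.
have dy0 : 0 < `|y - x| by rewrite normr_gt0 subr_eq0.
rewrite -(ler_pM2r dy0) -normrM mulrBl divfK ?subr_eq0 //.
by rewrite [in X in X -> _]distrC.
Qed.

Lemma slope_sub f g (l m : R) x : slope_at f l x -> slope_at g m x ->
  slope_at (fun t => f t - g t) (l - m) x.
Proof.
move=> df dg e e0; have e20 : 0 < e / 2 by rewrite divr_gt0.
have [d1 d10 H1] := df _ e20; have [d2 d20 H2] := dg _ e20.
exists (Num.min d1 d2); first by rewrite lt_min d10.
move=> y y0; rewrite lt_min => /andP[/(H1 _ y0) h1 /(H2 _ y0) h2].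
have -> : f y - g y - (f x - g x) - (l - m) * (y - x) =
  (f y - f x - l * (y - x)) - (g y - g x - m * (y - x)) by ring.
apply: le_trans (ler_normB _ _) _.
by have := lerD h1 h2; rewrite -mulrDl -splitr.
Qed.

Lemma slope_quad (A B c x : R) :
  slope_at (fun t => A * t + B * (t - c) ^+ 2) (A + 2 * B * (x - c)) x.
Proof.
move=> e e0; exists (e / (`|B| + 1)); first by rewrite divr_gt0 // ltr_wpDl.
move=> y y0 yd.
have -> : A * y + B * (y - c) ^+ 2 - (A * x + B * (x - c) ^+ 2) -
  (A + 2 * B * (x - c)) * (y - x) = B * (y - x) * (y - x) by ring.
rewrite normrM ler_wpM2r // normrM.
have B1 : 0 < `|B| + 1 by rewrite ltr_wpDl.
move: yd; rewrite ltr_pdivlMr // => /ltW; apply: le_trans.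
by rewrite mulrC ler_wpM2l // lerDl.
Qed.

Lemma nondecr_of_slope f (f' : R -> R) a b : 0 <= a -> a <= b ->
  (forall x, a <= x -> x <= b -> slope_at f (f' x) x) ->
  (forall x, a <= x -> x <= b -> 0 <= f' x) -> f a <= f b.
Proof.
move=> a0 ab df f'0; rewrite -subr_ge0; apply/ler_addgt0Pr => e e0.
have e'0 : 0 < e / (b - a + 1) by rewrite divr_gt0 // ltr_wpDl ?subr_ge0.
suff : - (e / (b - a + 1)) * (b - a) <= f b - f a.
  have : e / (b - a + 1) * (b - a) <= e.
    by rewrite mulrAC ler_pdivrMr ?ler_wpM2l ?ltW //; lra.
  by lra.
set e' := e / _ in e'0 *.
apply: (@interval_cousin (fun u v => - e' * (v - u) <= f v - f u)) => // [u v w *|x ax xb].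
  by lra.
have [d d0 Hd] := df x ax xb _ e'0; exists d => // u v au ux xv vb uvd.
have f'x := f'0 x ax xb.
have := Hd u (le_trans a0 au); have := Hd v (le_trans (le_trans a0 ax) xv).
rewrite (ger0_norm (_ : 0 <= v - x)) ?subr_ge0 // (ler0_norm (_ : u - x <= 0)) ?subr_le0 //.
have pv : 0 <= f' x * (v - x) by rewrite mulr_ge0 ?subr_ge0.
have pu : 0 <= f' x * (x - u) by rewrite mulr_ge0 ?subr_ge0.
move=> /(_ ltac:(lra)); rewrite ler_norml => /andP[hv _].
by move=> /(_ ltac:(lra)); rewrite ler_norml => /andP[_ hu]; lra.
Qed.

End Monotone.

Section AbsolutelyContinuous.
Import numFieldNormedType.Exports.
Local Open Scope classical_set_scope.
Local Open Scope ring_scope.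
Variable R : realType.
Let mu : measure _ _ := @lebesgue_measure R.

(** Cover the null set of bad points by an open set [U] of small measure.  A small
    interval around a good point increases [f] up to a small multiple of its
    length, and one around a bad point is contained in [U].  By Cousin's lemma
    [a, b] is cut into intervals of both kinds; those of the second kind have
    small total length, so that [f] decreases little on them by absolute
    continuity. *)
Lemma abs_continuous_nondecr (f : R -> R) a b : 0 <= a -> a <= b ->
  abs_continuous f a b ->
  {ae lebesgue_measure, forall t : R, 0 < t -> derivable f t 1 /\ 0 <= (f^`())%classic t} ->
  f a <= f b.
Proof.
move=> a0 ab ACf aef; rewrite -subr_ge0; apply/ler_addgt0Pr => e e0.
have e20 : 0 < e / 2 by rewrite divr_gt0.
have [d d0 Hd] := ACf _ e20.
have [N [mN N0 subN]] : mu.-negligible (~` [set t : R | 0 < t -> derivable f t 1 /\ 0 <= (f^`())%classic t] `|` [set 0]).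
  apply: negligibleU => //; apply/negligibleP => //; exact: lebesgue_measure_set1.
have [U [oU NU muU]] : exists U : set R, [/\ open U, N `<=` U & (mu U < d%:E)%E].
  have [|U [oU NU muU]] := lebesgue_regularity_outer mN _ d0.
    exact: (eq_ind_r (fun z => z < +oo)%E (ltry 0) N0).
  exists U; split => //; apply: le_lt_trans muU.
  have mU : measurable U by exact: measurable_realfun.open_measurable.
  have mUN : measurable (U `\` N) by exact: measurableD.
  have UE : (U `\` N) `|` N = U by rewrite setUC setDUK.
  by have := @measureU0 _ _ _ mu _ _ mUN mN N0; rewrite UE => ->.
have mU : measurable U by exact: measurable_realfun.open_measurable.
pose e' := e / 2 / (b - a + 1).
have e'0 : 0 < e' by rewrite divr_gt0 // ltr_wpDl ?subr_ge0.
(* [s] collects the intervals around bad points *)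
pose P u v := exists s : seq (R * R), [/\
   forall p, p \in s -> [/\ u <= p.1, p.1 <= p.2 & p.2 <= v],
   pairwise (fun p q => (p.2 <= q.1) || (q.2 <= p.1)) s,
   ((\sum_(p <- s) (p.2 - p.1))%:E <= mu (U `&` `]u, v]))%E
   & - e' * (v - u) - \sum_(p <- s) `|f p.2 - f p.1| <= f v - f u].
have [s [sab spw smu sf]] : P a b.
  apply: interval_cousin => // [u v w au uv vw wb|x ax xb].
    move=> [s1 [s1in s1pw s1mu s1f]] [s2 [s2in s2pw s2mu s2f]].
    exists (s1 ++ s2); split.
    - move=> p; rewrite mem_cat => /orP[/s1in|/s2in] [h1 h2 h3]; split=> //; lra.
    - rewrite pairwise_cat s1pw s2pw !andbT; apply/allrelP => p q /s1in[_ _ h1] /s2in[h2 _ _].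
      by rewrite (le_trans h1 h2).
    - rewrite big_cat EFinD.
      have -> : U `&` `]u, w] = (U `&` `]u, v]) `|` (U `&` `]v, w]).
        rewrite -setIUr; congr (_ `&` _); rewrite -itv_bndbnd_setU //.
      rewrite measureU; first exact: leeD.
      + by apply: measurableI.
      + by apply: measurableI.
      + apply/seteqP; split=> // t [[_ /=]]; rewrite in_itv /= => /andP[_ tv] [_].
        by rewrite /= in_itv /= => /andP[vt _]; move: (lt_le_trans vt tv); rewrite ltxx.
    - by rewrite big_cat /=; lra.
  have [Ux|NUx] := pselect (U x).
    have [r /= r0 rU] : nbhs_ball x U by apply/nbhs_ballP; move: oU; rewrite openE => /(_ x Ux).
    exists r => // u v au ux xv vb uvr; exists [:: (u, v)]; split.
    - by move=> p; rewrite inE => /eqP -> /=; split=> //; lra.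
    - by [].
    - rewrite big_seq1 /= (_ : U `&` `]u, v] = `]u, v]%classic).
        rewrite lebesgue_measure_itv /= lte_fin; case: ltP => [uv|vu]; first by rewrite EFinB.
        by rewrite lee_fin subr_le0.
      apply: setIidr => t /=; rewrite in_itv /= => /andP[ut tv]; apply: rU.
      by rewrite /ball /= ltr_distl; apply/andP; split; lra.
    - rewrite big_seq1 /=; have := ler_norm (- (f v - f u)); rewrite normrN.
      have : 0 <= e' * (v - u) by apply: mulr_ge0; [exact: ltW | lra].
      by lra.
  have [nx0 dfx] : x <> 0 /\ (0 < x -> derivable f x 1 /\ 0 <= (f^`())%classic x).
    by split; [move=> x0; apply/NUx/NU/subN; right | apply: contrapT => H; apply/NUx/NU/subN; left].
  have x0 : 0 < x by rewrite lt_def (le_trans a0 ax) andbT; apply/eqP.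
  have [dfx1 dfx2] := dfx x0.
  have sl : slope_at f ((f^`())%classic x) x.
    move=> eps eps0.
    have /cvgrPdist_lt/(_ eps eps0) :
        (fun h => h^-1 *: ((f \o shift x) (h *: 1) - f x)) @ 0^' --> (f^`())%classic x.
      by rewrite derive1E; exact: dfx1.
    rewrite /dnbhs near_withinE => /nbhs_ballP[r /= r0 Hr].
    exists r => // y y0 yr.
    have [->|yx] := eqVneq y x; first by rewrite !subrr mulr0 subrr normr0 mulr0.
    have := Hr (y - x); rewrite /ball /= sub0r normrN subr_eq0 => /(_ yr yx) /ltW.
    have dy0 : 0 < `|y - x| by rewrite normr_gt0 subr_eq0.
    rewrite -(ler_pM2r dy0) -normrM mulrBl /GRing.scale /= mulr1 subrK.
    by rewrite mulrAC mulVf ?subr_eq0 // mul1r [in X in X -> _]distrC.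
  have [r r0 Hr] := sl _ e'0; exists r => // u v au ux xv vb uvd.
  exists [::]; split=> //; first by rewrite big_nil.
  rewrite big_nil subr0.
  have := Hr u (le_trans a0 au); have := Hr v (le_trans (ltW x0) xv).
  rewrite (ger0_norm (_ : 0 <= v - x)) ?subr_ge0 // (ler0_norm (_ : u - x <= 0)) ?subr_le0 //.
  have pv : 0 <= (f^`())%classic x * (v - x) by rewrite mulr_ge0 ?subr_ge0.
  have pu : 0 <= (f^`())%classic x * (x - u) by rewrite mulr_ge0 ?subr_ge0.
  move=> /(_ ltac:(lra)); rewrite ler_norml => /andP[hv _].
  by move=> /(_ ltac:(lra)); rewrite ler_norml => /andP[_ hu]; lra.
have sd : \sum_(p <- s) (p.2 - p.1) < d.
  rewrite -lte_fin; apply: le_lt_trans muU; apply: le_trans smu _.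
  by apply: le_measure; rewrite ?inE //; apply: measurableI.
have := Hd s sab spw sd.
have : e' * (b - a) <= e / 2.
  by rewrite /e' mulrAC ler_pdivrMr ?ler_wpM2l ?ltW //; lra.
by lra.
Qed.

End AbsolutelyContinuous.

(** * From ramps to admissible functions *)

Section RampDominance.
Import numFieldNormedType.Exports.
Local Open Scope classical_set_scope.
Local Open Scope ring_scope.
Variable R : realType.

Section Taylor.
Variables (F F1 F2 : R -> R).
Hypothesis F_slope : forall x, 0 <= x -> slope_at F (F1 x) x.
Hypothesis F1_slope : forall x, 0 <= x -> slope_at F1 (F2 x) x.
Hypothesis F2_nondecr : forall u v, 0 <= u -> u <= v -> F2 u <= F2 v.

Lemma slope_bounds u v : 0 <= u -> u <= v ->
  F2 u * (v - u) <= F1 v - F1 u <= F2 v * (v - u).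
Proof.
move=> u0 uv; apply/andP; split.
  have := @nondecr_of_slope R (fun t => F1 t - (F2 u * t + 0 * (t - 0) ^+ 2)) (fun t => F2 t - (F2 u + 2 * 0 * (t - 0))) u v u0 uv.
  have H1 x : u <= x -> x <= v -> slope_at (fun t => F1 t - (F2 u * t + 0 * (t - 0) ^+ 2)) (F2 x - (F2 u + 2 * 0 * (x - 0))) x.
    by move=> ux _; apply: slope_sub; [apply: F1_slope; lra | exact: slope_quad].
  have H2 x : u <= x -> x <= v -> 0 <= F2 x - (F2 u + 2 * 0 * (x - 0)).
    by move=> ux _; have := F2_nondecr u0 ux; lra.
  by move=> /(_ H1 H2); lra.
have := @nondecr_of_slope R (fun t => (F2 v * t + 0 * (t - 0) ^+ 2) - F1 t) (fun t => (F2 v + 2 * 0 * (t - 0)) - F2 t) u v u0 uv.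
have H1 x : u <= x -> x <= v -> slope_at (fun t => (F2 v * t + 0 * (t - 0) ^+ 2) - F1 t) ((F2 v + 2 * 0 * (x - 0)) - F2 x) x.
  by move=> ux _; apply: slope_sub; [exact: slope_quad | apply: F1_slope; lra].
have H2 x : u <= x -> x <= v -> 0 <= (F2 v + 2 * 0 * (x - 0)) - F2 x.
  by move=> ux xv; have := F2_nondecr (le_trans u0 ux) xv; lra.
by move=> /(_ H1 H2); lra.
Qed.

Lemma taylor_bounds u v w : 0 <= u -> u <= v -> F2 v - F2 u <= w ->
  0 <= F v - F u - F1 u * (v - u) - F2 u * (v - u) ^+ 2 / 2 <= w * (v - u) ^+ 2 / 2.
Proof.
move=> u0 uv Fw; apply/andP; split.
  have := @nondecr_of_slope R (fun t => F t - (F1 u * t + F2 u / 2 * (t - u) ^+ 2)) (fun t => F1 t - (F1 u + 2 * (F2 u / 2) * (t - u))) u v u0 uv.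
  have H1 x : u <= x -> x <= v -> slope_at (fun t => F t - (F1 u * t + F2 u / 2 * (t - u) ^+ 2)) (F1 x - (F1 u + 2 * (F2 u / 2) * (x - u))) x.
    by move=> ux _; apply: slope_sub; [apply: F_slope; lra | exact: slope_quad].
  have H2 x : u <= x -> x <= v -> 0 <= F1 x - (F1 u + 2 * (F2 u / 2) * (x - u)).
    by move=> ux _; have /andP[+ _] := slope_bounds u0 ux; lra.
  by move=> /(_ H1 H2); lra.
have := @nondecr_of_slope R (fun t => (F1 u * t + (F2 u + w) / 2 * (t - u) ^+ 2) - F t) (fun t => (F1 u + 2 * ((F2 u + w) / 2) * (t - u)) - F1 t) u v u0 uv.
have H1 x : u <= x -> x <= v -> slope_at (fun t => (F1 u * t + (F2 u + w) / 2 * (t - u) ^+ 2) - F t) ((F1 u + 2 * ((F2 u + w) / 2) * (x - u)) - F1 x) x.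
  by move=> ux _; apply: slope_sub; [exact: slope_quad | apply: F_slope; lra].
have H2 x : u <= x -> x <= v -> 0 <= (F1 u + 2 * ((F2 u + w) / 2) * (x - u)) - F1 x.
  move=> ux xv; have /andP[_] := slope_bounds u0 ux.
  have : 0 <= (F2 u + w - F2 x) * (x - u).
    by apply: mulr_ge0; [have := F2_nondecr (le_trans u0 ux) xv; lra | lra].
  by lra.
by move=> /(_ H1 H2); lra.
Qed.

(** [F] up to [s], continued by its second order Taylor polynomial at [s]. *)
Definition quad_extension s t : R :=
  if t <= s then F t else F s + F1 s * (t - s) + F2 s * (t - s) ^+ 2 / 2.

(** As [s] grows, the continued function changes at half the rate of [F2], times
    the ramp at [s]: this is the discrete form of the statement that [F] is a
    mixture of ramps. *)
Lemma quad_extension_step u v t K : 0 <= u -> u <= v -> v <= K -> 0 <= t -> t <= K ->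
  `|quad_extension v t - quad_extension u t - (F2 v - F2 u) / 2 * ramp2 u t|
    <= 2 * K * (F2 v - F2 u) * (v - u).
Proof.
move=> u0 uv vK t0 tK; set w := F2 v - F2 u.
have w0 : 0 <= w by rewrite subr_ge0 F2_nondecr.
have vu0 : 0 <= v - u by lra.
have K0 : 0 <= K by lra.
rewrite /quad_extension; have [tu|ut] := leP t u.
  rewrite (le_trans tu uv) ramp2_low // subrr mulr0 subr0 normr0.
  by rewrite !mulr_ge0.
rewrite (ramp2_high (ltW ut)).
have wKv : 0 <= w * (K - (v - u)) * (v - u) by rewrite !mulr_ge0 //; lra.
have wvu : 0 <= w * (v - u) by rewrite mulr_ge0.
have [tv|vt] := leP t v.
  have Fw : F2 t - F2 u <= w by rewrite lerB // F2_nondecr //; lra.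
  have /andP[h1 h2] := taylor_bounds u0 (ltW ut) Fw.
  have h3 : w * (t - u) ^+ 2 <= w * (v - u) ^+ 2.
    by rewrite ler_wpM2l // lerXn2r ?nnegrE //; lra.
  have h4 : 0 <= w * (t - u) ^+ 2 by rewrite mulr_ge0 ?sqr_ge0.
  have h5 : 0 <= w * (v - u) * K by rewrite mulr_ge0.
  by rewrite ler_norml; apply/andP; split; lra.
have /andP[h1 h2] := taylor_bounds u0 uv (lexx w).
have /andP[g1 g2] := slope_bounds u0 uv.
have tv0 : 0 <= t - v by lra.
have p1 : 0 <= (F1 v - F1 u - F2 u * (v - u)) * (t - v) by rewrite mulr_ge0 // subr_ge0.
have p2 : (F1 v - F1 u - F2 u * (v - u)) * (t - v) <= w * (v - u) * (t - v).
  by rewrite ler_wpM2r // /w; lra.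
have p3 : 0 <= w * (v - u) * (K - t) by rewrite mulr_ge0 //; lra.
have p4 : 0 <= w * (v - u) * (t - v) by rewrite mulr_ge0.
have p5 : 0 <= w * (v - u) * v by rewrite mulr_ge0 //; lra.
have p6 : 0 <= w * (v - u) * u by rewrite mulr_ge0 //; lra.
have p7 : 0 <= w * (v - u) * (v - u) by rewrite mulr_ge0.
have F2E : F2 v = F2 u + w by rewrite /w; ring.
by rewrite ler_norml F2E; apply/andP; split; lra.
Qed.

End Taylor.

(** For large [s], the sum of [ramp2 (- s)] is, up to a constant and a bounded
    term, [2 * s] times the sum. *)
Lemma trace_le_of_ramp2 n (x y : 'I_n -> R) :
  (forall i, 0 <= x i) -> (forall i, 0 <= y i) ->
  (forall s, \sum_i ramp2 s (y i) <= \sum_i ramp2 s (x i)) ->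
  \sum_i y i <= \sum_i x i.
Proof.
move=> x0 y0 le_xy.
pose D2 := \sum_i x i ^+ 2 - \sum_i y i ^+ 2.
pose D1 := \sum_i x i - \sum_i y i.
have H s : 0 <= s -> 0 <= D2 + 2 * s * D1.
  move=> s0; have := le_xy (- s).
  have E (z : 'I_n -> R) : (forall i, 0 <= z i) ->
      \sum_i ramp2 (- s) (z i) = \sum_i z i ^+ 2 + 2 * s * \sum_i z i + \sum_(i < n) s ^+ 2.
    move=> z0; rewrite mulr_sumr -!big_split; apply: eq_bigr => i _ /=.
    by rewrite ramp2_high; [ring | have := z0 i; lra].
  by rewrite !E // /D2 /D1; lra.
rewrite -subr_ge0 -/D1 leNgt; apply/negP => D10.
have D20 := H 0 (lexx 0).
have := H ((D2 + 1) / (- 2 * D1)).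
have -> : D2 + 2 * ((D2 + 1) / (- 2 * D1)) * D1 = - 1.
  by field; rewrite lt_eqF.
by rewrite divr_ge0 //; [move=> /(_ isT) |..]; lra.
Qed.

(** Let [A G] be the difference of the two sums of [G].  It is nonnegative for the
    Taylor polynomial of [F] at [0], equal to [A F] when [F] is continued beyond all
    points, and in between it increases, up to arbitrarily small errors, by
    [quad_extension_step] and Cousin's lemma. *)
Lemma admissible_sum_le (F : R -> R) n (x y : 'I_n -> R) : admissible F ->
  (forall i, 0 <= x i) -> (forall i, 0 <= y i) ->
  (forall s, \sum_i ramp2 s (y i) <= \sum_i ramp2 s (x i)) ->
  \sum_i F (y i) <= \sum_i F (x i).
Proof.
case=> F1 [F2 [dF dF1 _ F2ac [_ F10 F20 F2ae]]] x0 y0 le_xy.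
have F_slope := has_deriv_slope dF; have F1_slope := has_deriv_slope dF1.
have F2_nondecr u v : 0 <= u -> u <= v -> F2 u <= F2 v.
  by move=> u0 uv; apply: (abs_continuous_nondecr u0 uv (F2ac u v u0 uv) F2ae).
pose K := \sum_i x i + \sum_i y i.
have sx0 : 0 <= \sum_i x i by apply: sumr_ge0.
have sy0 : 0 <= \sum_i y i by apply: sumr_ge0.
have K0 : 0 <= K by rewrite addr_ge0.
have xK i : x i <= K.
  by apply: ler_wpDr => //; rewrite (bigD1 i) //= lerDl sumr_ge0.
have yK i : y i <= K.
  by apply: ler_wpDl => //; rewrite (bigD1 i) //= lerDl sumr_ge0.
pose A (G : R -> R) := \sum_i G (x i) - \sum_i G (y i).
have A0 : 0 <= A (quad_extension F F1 F2 0).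
  have E (z : 'I_n -> R) : (forall i, 0 <= z i) ->
      \sum_i quad_extension F F1 F2 0 (z i) =
      \sum_(i < n) F 0 + F1 0 * \sum_i z i + F2 0 / 2 * \sum_i ramp2 0 (z i).
    move=> z0; rewrite !mulr_sumr -!big_split; apply: eq_bigr => i _ /=.
    rewrite ramp2_high // /quad_extension; case: ifP => zi0; last by ring.
    by have -> : z i = 0; [apply/le_anti; rewrite zi0 z0 | ring].
  rewrite /A !E //.
  have p1 : 0 <= F1 0 * (\sum_i x i - \sum_i y i).
    by rewrite mulr_ge0 // subr_ge0 trace_le_of_ramp2.
  have p2 : 0 <= F2 0 * (\sum_i ramp2 0 (x i) - \sum_i ramp2 0 (y i)).
    by rewrite mulr_ge0 // subr_ge0.
  by lra.
have AK : A (quad_extension F F1 F2 K) = A F.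
  by rewrite /A; congr (_ - _); apply: eq_bigr => i _; rewrite /quad_extension ?xK ?yK.
rewrite -subr_ge0 -/(A F) -AK; apply/ler_addgt0Pr => e e0.
pose e1 := e / (K + 1).
have e10 : 0 < e1 by rewrite divr_gt0 // ltr_wpDl.
pose c := 2 * (2 * K) * n%:R + 1.
have c0 : 0 < c by rewrite ltr_wpDl // !mulr_ge0.
have [d d0 Hd] := F2ac 0 K (lexx 0) K0 (e1 / c) (divr_gt0 e10 c0).
suff : - e1 * (K - 0) <= A (quad_extension F F1 F2 K) - A (quad_extension F F1 F2 0).
  have : e1 * K <= e by rewrite /e1 mulrAC ler_pdivrMr ?ler_wpM2l ?ltW //; lra.
  by lra.
apply: (@interval_cousin _ (fun u v => - e1 * (v - u) <=
  A (quad_extension F F1 F2 v) - A (quad_extension F F1 F2 u))) => // [u v w *|z z0 zK].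
  by lra.
exists d => // u v u0 uz zv vK uvd; have uv := le_trans uz zv.
have w0 : 0 <= F2 v - F2 u by rewrite subr_ge0 F2_nondecr.
have w1 : F2 v - F2 u <= e1 / c.
  have := Hd [:: (u, v)]; rewrite !big_seq1 /= => /(_ _ isT uvd)/ltW H.
  apply: le_trans (ler_norm _) (H _) => p; rewrite inE => /eqP -> /=.
  by split.
pose T t := quad_extension F F1 F2 v t - quad_extension F F1 F2 u t.
pose E := 2 * K * (F2 v - F2 u) * (v - u).
have sE (p : 'I_n -> R) e' : \sum_i ((F2 v - F2 u) / 2 * ramp2 u (p i) + e') =
    (F2 v - F2 u) / 2 * \sum_i ramp2 u (p i) + e' *+ n.
  by rewrite big_split /= -mulr_sumr sumr_const card_ord.
have bx : \sum_i ((F2 v - F2 u) / 2 * ramp2 u (x i) - E) <= \sum_i T (x i).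
  apply: ler_sum => i _; have := quad_extension_step F_slope F1_slope F2_nondecr u0 uv vK (x0 i) (xK i).
  by rewrite ler_norml -/(T _) -/E => /andP[h _]; lra.
have by_ : \sum_i T (y i) <= \sum_i ((F2 v - F2 u) / 2 * ramp2 u (y i) + E).
  apply: ler_sum => i _; have := quad_extension_step F_slope F1_slope F2_nondecr u0 uv vK (y0 i) (yK i).
  by rewrite ler_norml -/(T _) -/E => /andP[_ h]; lra.
have -> : A (quad_extension F F1 F2 v) - A (quad_extension F F1 F2 u) =
    \sum_i T (x i) - \sum_i T (y i) by rewrite /A /T !sumrB; ring.
move: bx by_; rewrite !sE mulNrn; clearbody T.
have := le_xy u; set rx := \sum_i ramp2 u (x i); set ry := \sum_i ramp2 u (y i).
move=> rxy bx by_.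
have h1 : 0 <= (F2 v - F2 u) * (rx - ry) by rewrite mulr_ge0 // subr_ge0.
have h2 : E *+ n *+ 2 <= e1 * (v - u).
  have -> : E *+ n *+ 2 = (F2 v - F2 u) * ((c - 1) * (v - u)).
    by rewrite -(mulr_natr E) -(mulr_natr (E * n%:R)) /E /c; ring.
  have c1 : 0 <= (c - 1) * (v - u) by rewrite mulr_ge0 ?subr_ge0 // /c lerDr !mulr_ge0.
  apply: le_trans (ler_wpM2r c1 w1) _.
  rewrite mulrA ler_wpM2r ?subr_ge0 // mulrAC ler_pdivrMr // ler_wpM2l ?ltW //.
  by rewrite ltrBlDr ltrDl.
by rewrite mulr2n in h2; lra.
Qed.

End RampDominance.

(** * Eigenvalues of real symmetric matrices *)

Lemma exists_left_null (F : fieldType) n m (K : 'M[F]_(n, m)) : (m < n)%N ->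
  exists2 v : 'rV[F]_n, v != 0 & v *m K = 0.
Proof.
move=> ltmn; have kerK0 : kermx K != 0.
  rewrite -mxrank_eq0 mxrank_ker -lt0n subn_gt0.
  by apply: leq_ltn_trans ltmn; apply: rank_leq_col.
exists (nz_row (kermx K)); first by rewrite nz_row_eq0.
by apply/eqP; rewrite -sub_kermx nz_row_sub.
Qed.

Lemma nth_le_of_count (R : realDomainType) (s t : seq R) k i :
  sorted >=%R s -> sorted >=%R t -> size s = size t -> (i + k < size s)%N ->
  (forall x : R, count (fun y => x < y)%R s <= count (fun y => x < y)%R t + k)%N ->
  nth 0 s (i + k) <= nth 0 t i.
Proof.
move=> ss st szst ltik cst; rewrite leNgt; apply/negP => lt_ts.
have ltit : (i < size t)%N by rewrite -szst (leq_ltn_trans _ ltik) ?leq_addr.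
have ge_tr : transitive (>=%R : rel R) by move=> a b c /= ba ca; apply: le_trans ca ba.
set x := nth 0 t i in lt_ts.
have cs : (i + k < count (fun y => x < y)%R s)%N.
  rewrite -(cat_take_drop (i + k).+1 s) count_cat ltn_addr //.
  have : all (fun y => x < y) (take (i + k).+1 s).
    apply/(all_nthP 0) => j; rewrite size_takel // => ltj.
    rewrite nth_take //; apply: lt_le_trans lt_ts _.
    move: ltj; rewrite ltnS leq_eqVlt => /predU1P[-> //|ltj].
    by apply: (sorted_ltn_nth ge_tr) => //; rewrite inE ?(ltn_trans ltj).
  by rewrite all_count => /eqP ->; rewrite size_takel.
have ct : (count (fun y => x < y)%R t <= i)%N.
  rewrite -(cat_take_drop i t) count_cat.
  have -> : count (fun y => x < y)%R (drop i t) = 0%N.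
    apply/eqP; rewrite -leqn0 leqNgt -has_count -all_predC.
    apply/(all_nthP 0) => j; rewrite size_drop => ltj /=.
    rewrite nth_drop -leNgt; case: j ltj => [|j] ltj; first by rewrite addn0.
    apply: (sorted_ltn_nth ge_tr) => //; rewrite ?inE //.
      by rewrite -ltn_subRL.
    by rewrite -[X in (X < _)%N]addn0 ltn_add2l.
  by rewrite addn0 (leq_trans (count_size _ _)) // size_take; case: ifP => // /negbT; rewrite -leqNgt.
have := cst x; rewrite leqNgt => /negP; apply.
by apply: leq_ltn_trans cs; rewrite leq_add2r.
Qed.

Section Spectrum.
Local Open Scope sesquilinear_scope.
Variable R : realType.
Local Notation C := (complex R).
Local Notation toC := (real_complex R).
Local Notation "M %:CM" := (map_mx toC M) (at level 2).

(** The rows of [P] are an orthonormal basis of eigenvectors.  They may be complex: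
    the spectral theorem is applied over the algebraic closure, and what is needed
    from the basis are the dimensions of its spans. *)
Definition diagonalized n (M : 'M[R]_n) (P : 'M[C]_n) (d : 'rV[R]_n) : Prop :=
  P \is unitarymx /\ M%:CM = P^t* *m diag_mx d%:CM *m P.

Lemma symmetric_diagonalized n (M : 'M[R]_n) : M^T = M ->
  exists P d, diagonalized M P d.
Proof.
move=> Msym; pose A : 'M[C]_n := M%:CM.
have Ah : A \is hermsymmx.
  apply: realsym_hermsym.
    by apply/is_hermitianmxP; rewrite /= expr0 scale1r map_mx_id // /A map_trmx Msym.
  by apply/mxOverP => i j; rewrite mxE; apply/complex_realP; exists (M i j).
have /orthomx_spectralP AE := hermitian_normalmx Ah.
have /mxOverP dreal := hermitian_spectral_diag_real Ah.
exists (spectralmx A), (map_mx (@complex.Re R) (spectral_diag A)); split.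
  exact: spectral_unitarymx.
rewrite invmx_unitary ?spectral_unitarymx // in AE.
apply: etrans AE _; congr (_ *m diag_mx _ *m _).
by apply/matrixP => i j; rewrite !mxE RRe_real.
Qed.

Lemma char_poly_diagonalized n (M : 'M[R]_n) P d : diagonalized M P d ->
  char_poly M = \prod_(x <- codom (d 0)) ('X - x%:P).
Proof.
case=> Pu ME; apply: (map_poly_inj toC).
rewrite map_char_poly ME.
have -> : char_poly (P^t* *m diag_mx d%:CM *m P) = char_poly (diag_mx d%:CM).
  rewrite /char_poly /char_poly_mx !map_mxM /=.
  have PP : map_mx polyC (P^t*) *m map_mx polyC P = 1%:M.
    by rewrite -map_mxM -invmx_unitary // mulVmx ?map_mx1 ?unitarymx_unit.
  have XE : 'X%:M = map_mx polyC (P^t*) *m 'X%:M *m map_mx polyC P.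
    by rewrite mul_mx_scalar -scalemxAl PP scalemx1.
  rewrite {1}XE -mulmxBl -mulmxBr !det_mulmx mulrAC -det_mulmx PP det1 mul1r //.
rewrite char_poly_trig ?diag_mx_is_trig // codomE big_map big_enum rmorph_prod /=.
by apply: eq_bigr => i _; rewrite rmorphB /= map_polyX map_polyC !mxE eqxx.
Qed.

Lemma spectrum_diagonalized n (M : 'M[R]_n) P d : diagonalized M P d ->
  perm_eq (spectrum M) (codom (d 0)).
Proof.
move=> MPd; rewrite /spectrum perm_sort; apply/allP => y _ /=.
have pN0 : char_poly M != 0 by rewrite monic_neq0 ?char_poly_monic.
have <- : mup y (char_poly M) = count_mem y (codom (d 0)).
  by rewrite (char_poly_diagonalized MPd) mu_prod_XsubC.
rewrite count_flatten -map_comp.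
rewrite (eq_map (g := fun x => ((x == y) * mup x (char_poly M))%N)); last first.
  by move=> x /=; rewrite count_nseq.
rewrite sumnE big_map.
have roots_uniq : uniq (rootsR (char_poly M)) by apply: uniq_roots.
have [yr|yNr] := boolP (y \in rootsR (char_poly M)).
  rewrite (bigD1_seq y) //= eqxx mul1n big1 ?addn0 // => x /negPf xy.
  by rewrite xy mul0n.
rewrite big_seq big1; last first.
  by move=> x xr; case: eqP => [xy|_ //]; rewrite -xy xr in yNr.
rewrite mupNroot // rootE; apply: contra yNr => /eqP ry.
by rewrite -roots_on_rootsR // inE rootE ry eqxx.
Qed.

Lemma size_spectrum n (M : 'M[R]_n) : M^T = M -> size (spectrum M) = n.
Proof.
move=> /symmetric_diagonalized [P [d MPd]].
by rewrite (perm_size (spectrum_diagonalized MPd)) size_codom card_ord.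
Qed.

Lemma sum_lambda (F : R -> R) n (M : 'M[R]_n) P d : diagonalized M P d ->
  \sum_(i < n) F (lambda M i) = \sum_(i < n) F (d 0 i).
Proof.
move=> MPd; have szs : size (spectrum M) = n.
  by rewrite (perm_size (spectrum_diagonalized MPd)) size_codom card_ord.
have -> : \sum_(i < n) F (lambda M i) = \sum_(x <- spectrum M) F x.
  by rewrite (big_nth 0) szs big_mkord.
by rewrite (perm_big _ (spectrum_diagonalized MPd)) codomE big_map big_enum.
Qed.

Lemma diagonalized_expr n (M : 'M[R]_n) P d k : diagonalized M P d ->
  \tr (iter k (mulmx M) 1%:M) = \sum_(i < n) d 0 i ^+ k.
Proof.
case=> Pu ME; apply: (@complexI R).
have PP : P *m P^t* = 1%:M by apply/unitarymxP.
have PP' : P^t* *m P = 1%:M by rewrite -invmx_unitary // mulVmx ?unitarymx_unit.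
have iterE : (iter k (mulmx M) 1%:M)%:CM = P^t* *m iter k (mulmx (diag_mx d%:CM)) 1%:M *m P.
  elim: k => [|k IH]; first by rewrite /= map_mx1 mulmx1.
  by rewrite !iterS map_mxM IH ME !mulmxA mulmxtVK.
have diagE : iter k (mulmx (diag_mx d%:CM)) 1%:M = diag_mx (map_mx (fun x => toC (x ^+ k)) d).
  elim: k {iterE} => [|k IH].
    by rewrite /=; apply/matrixP => i j; rewrite !mxE expr0.
  rewrite iterS IH mulmx_diag; congr diag_mx; apply/rowP => i.
  by rewrite !mxE exprS rmorphM.
rewrite -trace_map_mx iterE mxtrace_mulC mulmxA PP mul1mx diagE mxtrace_diag rmorph_sum.
by apply: eq_bigr => i _; rewrite mxE.
Qed.

Lemma sum_lambda_expr n (M : 'M[R]_n) k : M^T = M ->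
  \sum_(i < n) lambda M i ^+ k = \tr (iter k (mulmx M) 1%:M).
Proof.
move=> /symmetric_diagonalized [P [d MPd]].
by rewrite (sum_lambda (fun x => x ^+ k) MPd) (diagonalized_expr k MPd).
Qed.

Lemma lambda_eigenvalue n (M : 'M[R]_n) i : M^T = M -> (i < n)%N ->
  eigenvalue M (lambda M i).
Proof.
move=> Msym ltin; have [P [d MPd]] := symmetric_diagonalized Msym.
rewrite eigenvalue_root_char (char_poly_diagonalized MPd) root_prod_XsubC.
by rewrite -(perm_mem (spectrum_diagonalized MPd)) mem_nth ?size_spectrum.
Qed.

Local Notation form x M := ((x *m M%:CM *m x^t*) 0 0).

Lemma form_diagonalized n (M : 'M[R]_n) P d (x : 'rV[C]_n) : diagonalized M P d ->
  form x M = \sum_i toC (d 0 i) * `|(x *m P^t*) 0 i| ^+ 2.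
Proof.
case=> Pu ME; rewrite ME.
have -> : x *m (P^t* *m diag_mx d%:CM *m P) *m x^t* =
  (x *m P^t*) *m diag_mx d%:CM *m (x *m P^t*)^t*.
  by rewrite trmx_mul map_mxM trmxCK !mulmxA.
rewrite mxE; apply: eq_bigr => i _.
by rewrite mul_mx_diag !mxE normCK; ring.
Qed.

Lemma norm_diagonalized n (P : 'M[C]_n) (x : 'rV[C]_n) : P \is unitarymx ->
  (x *m x^t*) 0 0 = \sum_i `|(x *m P^t*) 0 i| ^+ 2.
Proof.
move=> Pu; have -> : x *m x^t* = (x *m P^t*) *m (x *m P^t*)^t*.
  rewrite trmx_mul map_mxM trmxCK mulmxA -(mulmxA x).
  by rewrite -invmx_unitary // mulVmx ?unitarymx_unit // mulmx1.
by rewrite mxE; apply: eq_bigr => i _; rewrite !mxE normCK.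
Qed.

(** Courant-Fischer by counting dimensions.  If [M] had more than [k] eigenvalues
    above [t] in excess of [M'], some nonzero [x] with [x *m B = 0] would be orthogonal
    to the eigenvectors of [M] with eigenvalue at most [t] and to those of [M'] with
    eigenvalue above [t], so that the form of [M] at [x] would exceed [t] times the
    norm and the form of [M'] would not. *)
Lemma count_eigen_le n k (M M' : 'M[R]_n) P d P' d' (B : 'M[C]_(n, k)) (t : R) :
  diagonalized M P d -> diagonalized M' P' d' ->
  (forall x : 'rV[C]_n, x *m B = 0 -> form x M <= form x M') ->
  (#|[pred i | (t < d 0 i)%R]| <= #|[pred i | (t < d' 0 i)%R]| + k)%N.
Proof.
move=> MPd MPd' le_form; rewrite leqNgt; apply/negP => ltk.
pose lo := [pred i | ~~ (t < d 0 i)]; pose hi := [pred i | t < d' 0 i].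
pose K := row_mx (colsub (fun i : 'I_#|lo| => enum_val i) (P^t*))
  (row_mx (colsub (fun i : 'I_#|hi| => enum_val i) (P'^t*)) B).
have [|v v0 vK] := @exists_left_null _ _ _ K.
  have cE := cardC [pred i | (t < d 0 i)%R]; rewrite card_ord in cE.
  apply: leq_trans (eq_leq cE); rewrite -addnS addnC; apply: leq_add; first exact: ltk.
  apply: subset_leq_card; apply/fintype.subsetP => i; by rewrite !inE.
move: vK; rewrite /K !mul_mx_row => /eqP; rewrite row_mx_eq0 row_mx_eq0.
case/and3P => /eqP vlo /eqP vhi /eqP vB.
have c0 i : ~~ (t < d 0 i) -> (v *m P^t*) 0 i = 0.
  move=> ilo; have iin : i \in lo by [].
  have /matrixP/(_ 0 (enum_rank_in iin i)) := vlo.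
  rewrite mxE [RHS]mxE => <-; rewrite mxE; apply: eq_bigr => j _.
  by rewrite !mxE enum_rankK_in.
have c0' i : t < d' 0 i -> (v *m P'^t*) 0 i = 0.
  move=> ilo; have iin : i \in hi by [].
  have /matrixP/(_ 0 (enum_rank_in iin i)) := vhi.
  rewrite mxE [RHS]mxE => <-; rewrite mxE; apply: eq_bigr => j _.
  by rewrite !mxE enum_rankK_in.
have vv0 : 0 < (v *m v^t*) 0 0.
  rewrite mxE lt_def; apply/andP; split; last first.
    by apply: sumr_ge0 => i _; rewrite !mxE -normCK exprn_ge0.
  rewrite psumr_eq0; last by move=> i _; rewrite !mxE -normCK exprn_ge0.
  apply: contra v0 => /allP v0; apply/eqP/rowP => i; rewrite mxE.
  have := v0 i (mem_index_enum _); rewrite !mxE -normCK /= expf_eq0 normr_eq0 /=.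
  by move/eqP.
have ub : form v M' <= toC t * (v *m v^t*) 0 0.
  rewrite (form_diagonalized v MPd') (norm_diagonalized v MPd'.1) mulr_sumr.
  apply: ler_sum => i _; have [lt_t|le_t] := boolP (t < d' 0 i).
    by rewrite c0' // normr0 expr0n !mulr0.
  by apply: ler_wpM2r; rewrite ?exprn_ge0 // lecR leNgt.
have lb : toC t * (v *m v^t*) 0 0 < form v M.
  rewrite (form_diagonalized v MPd) (norm_diagonalized v MPd.1) mulr_sumr.
  rewrite -subr_gt0 -sumrB lt_def.
  have ge0 i : 0 <= toC (d 0 i) * `|(v *m P^t*) 0 i| ^+ 2 - toC t * `|(v *m P^t*) 0 i| ^+ 2.
    rewrite -mulrBl; have [lt_t|le_t] := boolP (t < d 0 i).
      by rewrite mulr_ge0 ?exprn_ge0 // subr_ge0 lecR ltW.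
    by rewrite c0 // normr0 expr0n mulr0.
  apply/andP; split; last by apply: sumr_ge0 => i _.
  rewrite psumr_eq0 //; apply: contraTN vv0 => /allP all0.
  rewrite (norm_diagonalized v MPd.1) big1 ?ltxx // => i _.
  have := all0 i (mem_index_enum _); rewrite /= -mulrBl mulf_eq0 => /orP[|/eqP //].
  rewrite subr_eq0 => /eqP/complexI dt.
  by rewrite c0 ?normr0 ?expr0n // dt ltxx.
by have := lt_le_trans lb (le_trans (le_form v vB) ub); rewrite ltxx.
Qed.

Lemma lambda_shift_le n k (M M' : 'M[R]_n) (B : 'M[C]_(n, k)) i :
  M^T = M -> M'^T = M' ->
  (forall x : 'rV[C]_n, x *m B = 0 -> form x M <= form x M') ->
  (i + k < n)%N -> lambda M (i + k) <= lambda M' i.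
Proof.
move=> Ms Ms' le_form lti; rewrite /lambda.
have [P [d MPd]] := symmetric_diagonalized Ms.
have [P' [d' MPd']] := symmetric_diagonalized Ms'.
have ge_total : total (>=%R : rel R) by move=> a b /=; apply: le_total.
apply: nth_le_of_count; rewrite ?size_spectrum ?sort_sorted // => x.
rewrite (seq.permP (spectrum_diagonalized MPd)) (seq.permP (spectrum_diagonalized MPd')).
have cE (f : 'rV[R]_n) : count (fun y => x < y) (codom (f 0)) = #|[pred i | (x < f 0 i)%R]|.
  by rewrite codomE count_map cardE size_filter enumT.
by rewrite !cE; apply: count_eigen_le MPd MPd' le_form.
Qed.

End Spectrum.

(** * Rank one perturbations *)

Section RankOne.
Local Open Scope sesquilinear_scope.
Variables (R : realType) (n : nat).
Local Notation C := (complex R).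
Local Notation toC := (real_complex R).
Variables (M0 : 'M[R]_n) (b : 'rV[R]_n).
Hypothesis M0sym : M0^T = M0.
Let M := M0 + b^T *m b.

Lemma rank_one_sym : M^T = M.
Proof. by rewrite /M linearD /= trmx_mul trmxK M0sym. Qed.

Lemma rank_one_form (x : 'rV[C]_n) :
  (x *m map_mx toC M *m x^t*) 0 0 =
  (x *m map_mx toC M0 *m x^t*) 0 0 + `|(x *m map_mx toC b^T) 0 0| ^+ 2.
Proof.
rewrite /M map_mxD map_mxM mulmxDr mulmxDl mxE; congr (_ + _).
have -> : x *m (map_mx toC b^T *m map_mx toC b) *m x^t* =
   (x *m map_mx toC b^T) *m (x *m map_mx toC b^T)^t*.
  rewrite trmx_mul map_mxM mulmxA -!mulmxA; congr (_ *m (_ *m (_ *m _))).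
  by apply/matrixP => i j; rewrite !mxE; apply/esym/CrealP/complex_realP; exists (b i j).
by rewrite mxE big_ord1 normCK !mxE.
Qed.

(** Adding [b^T *m b] increases the quadratic form, which moves every eigenvalue up;
    the two forms agree on the hyperplane orthogonal to [b], which stops each
    eigenvalue at the next one of [M0]. *)
Lemma rank_one_interlaced a U :
  (forall c, eigenvalue M0 c -> a <= c) -> (forall c, eigenvalue M c -> c <= U) ->
  interlaced n (lambda M) (lambda M0) a U.
Proof.
move=> M0a MU; split=> i ltin.
- exact/M0a/lambda_eigenvalue.
- exact/MU/lambda_eigenvalue/ltin/rank_one_sym.
- have := @lambda_shift_le R n 0 M0 M (0 : 'M[C]_(n, 0)) i M0sym rank_one_sym.
  rewrite addn0; apply=> // x _; rewrite rank_one_form lerDl exprn_ge0 //.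
- have := @lambda_shift_le R n 1 M M0 (map_mx toC b^T) i rank_one_sym M0sym.
  rewrite addn1; apply=> // x xb.
  by rewrite rank_one_form xb [X in Num.norm X]mxE normr0 expr0n addr0.
Qed.

(** Expand the traces of the powers of [M0 + b^T *m b]: by cyclicity each word
    containing [b] is a product of numbers [b *m M0 ^ k *m b^T]. *)
Lemma rank_one_moments (nu al be : R) :
  b *m b^T = nu%:M -> b *m M0 *m b^T = al%:M -> b *m M0 *m M0 *m b^T = be%:M ->
  [/\ gain id n (lambda M) (lambda M0) = nu,
      gain (fun t => t ^+ 2) n (lambda M) (lambda M0) = 2 * al + nu ^+ 2
    & gain (fun t => t ^+ 3) n (lambda M) (lambda M0) = 3 * be + 3 * nu * al + nu ^+ 3].
Proof.
move=> bb bMb bMMb.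
have gE k : gain (fun t => t ^+ k) n (lambda M) (lambda M0) =
    \tr (iter k (mulmx M) 1%:M) - \tr (iter k (mulmx M0) 1%:M).
  by rewrite /gain sumrB !sum_lambda_expr // rank_one_sym.
move: gE; rewrite /M; set B := b^T *m b => gE.
have trB X (c : R) : b *m X *m b^T = c%:M -> \tr (X *m B) = c.
  by move=> Xc; rewrite mulmxA mxtrace_mulC mulmxA Xc mxtrace_scalar.
have B2 : B *m B = nu *: B.
  by rewrite /B mulmxA -(mulmxA b^T) bb mul_mx_scalar -scalemxAl.
have t1 : \tr B = nu by rewrite -[B]mul1mx; apply: trB; rewrite mulmx1.
have t2 : \tr (M0 *m B) = al by exact: trB.
have t3 : \tr (M0 *m (M0 *m B)) = be by rewrite mulmxA; apply: trB; rewrite mulmxA.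
have rot (X Y Z : 'M[R]_n) : \tr (X *m (Y *m Z)) = \tr (Y *m (Z *m X)) :> R.
  by rewrite mxtrace_mulC mulmxA.
split.
- have := gE 1%N; rewrite /= !mulmx1 linearD /= t1 addrAC subrr add0r => <-.
  by apply: eq_bigr.
- have := gE 2; rewrite /= !mulmx1 => ->.
  rewrite mulmxDl !mulmxDr !linearD /= (mxtrace_mulC B M0) t2 B2 linearZ /= t1; ring.
have := gE 3; rewrite /= !mulmx1 => ->.
rewrite !(mulmxDl, mulmxDr) !linearD /= (rot B M0 M0) (rot M0 B M0) (rot B M0 M0).
rewrite (rot B B M0) !(rot B M0 B) B2 -!scalemxAr !linearZ /= !t3 B2 !linearZ /= t1 t2; ring.
Qed.
End RankOne.

(** * The matrix of a graph and the deletion of an edge *)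

Section GraphMatrix.
Variables (R : realType) (sg : R).
Hypothesis sg1 : sg ^+ 2 = 1.

(** The Laplacian for [sg = -1] and the signless Laplacian for [sg = 1]. *)
Definition signed_laplacian n (G : sgraph n) : 'M[R]_n :=
  degree_mx R G + sg *: adjacency_mx R G.
Local Notation L := signed_laplacian.

Lemma signed_laplacianE n (G : sgraph n) u v :
  L G u v = (degree G v)%:R *+ (u == v) + sg * (G u v)%:R.
Proof. by rewrite !mxE; case: eqP => [->|_]. Qed.

Lemma signed_laplacian_sym n (G : sgraph n) : (L G)^T = L G.
Proof.
apply/matrixP => u v; rewrite mxE !signed_laplacianE adj_sym eq_sym.
by case: eqP => [->|].
Qed.

Lemma sum_adj n (G : sgraph n) u (f : 'I_n -> R) :
  \sum_w f w * (G w u)%:R = \sum_(w | G u w) f w.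
Proof.
rewrite [RHS]big_mkcond; apply: eq_bigr => w _; rewrite adj_sym.
by case: (G u w); rewrite (mulr1, mulr0).
Qed.

Lemma degreeE n (G : sgraph n) u : (degree G u)%:R = \sum_(w | G u w) 1 :> R.
Proof. by rewrite sumr_const; congr _%:R; apply: eq_card => w; rewrite !inE. Qed.

Lemma normr_sg : `|sg| = 1.
Proof.
by apply/eqP; rewrite -(eqrXn2 (n := 2)) // expr1n -normrX sg1 normr1.
Qed.

Section Eigenvalues.
Variables (n : nat) (G : sgraph n) (v : 'rV[R]_n) (c : R).
Hypothesis v_eigen : v *m L G = c *: v.

Lemma eigen_coord u : c * v 0 u = (degree G u)%:R * v 0 u + sg * \sum_(w | G u w) v 0 w.
Proof.
have /rowP/(_ u) := v_eigen; rewrite !mxE => <-.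
under eq_bigr do rewrite signed_laplacianE mulrDr.
rewrite big_split /=; congr (_ + _); last first.
  by rewrite -sum_adj mulr_sumr; apply: eq_bigr => w _; ring.
rewrite (bigD1 u) //= eqxx mulr1n big1 ?addr0 1?mulrC // => w /negPf wu.
by rewrite wu mulr0n mulr0.
Qed.

Lemma eigen_edge_coord u : c * v 0 u = \sum_(w | G u w) (v 0 u + sg * v 0 w).
Proof.
rewrite eigen_coord big_split /= degreeE mulr_suml mulr_sumr; congr (_ + _).
by apply: eq_bigr => w _; rewrite mul1r.
Qed.

(** Gershgorin's argument at a coordinate of largest modulus. *)
Lemma eigen_ge0 : v != 0 -> 0 <= c.
Proof.
move=> v0; have [u vu] : exists u, v 0 u != 0.
  apply/existsP; apply: contraR v0; rewrite negb_exists => /forallP v0.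
  by apply/eqP/rowP => u; rewrite mxE; apply/eqP; have := v0 u; rewrite negbK.
pose m := [arg max_(i > u) `|v 0 i|]%O.
have mP w : `|v 0 w| <= `|v 0 m|.
  by rewrite /m; case: Order.TotalTheory.arg_maxP => // i _; apply.
have m0 : 0 < `|v 0 m| by apply: lt_le_trans (mP u); rewrite normr_gt0.
have : `|(c - (degree G m)%:R) * v 0 m| <= (degree G m)%:R * `|v 0 m|.
  rewrite mulrBl eigen_coord addrAC subrr add0r normrM normr_sg mul1r.
  apply: le_trans (ler_norm_sum _ _ _) _.
  by rewrite degreeE mulr_suml; apply: ler_sum => w _; rewrite mul1r.
rewrite normrM ler_pM2r // ler_norml => /andP[+ _].
by rewrite lerBrDr addrC subrr.
Qed.

(** Gershgorin's argument for the edge version of the matrix: the function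
    [y (a, b) = v_a + sg * v_b] on the oriented edges is multiplied by [c] when each
    value is replaced by a signed sum of the values at the edges meeting [a] and
    [b], of which there are [degree a + degree b]. *)
Lemma eigen_le_edge_degrees k :
  (forall x y, G x y -> (degree G x + degree G y <= k)%N) -> v != 0 -> c <= k%:R.
Proof.
move=> dk v0; pose y (p : 'I_n * 'I_n) := v 0 p.1 + sg * v 0 p.2.
have [u vu] : exists u, v 0 u != 0.
  apply/existsP; apply: contraR v0; rewrite negb_exists => /forallP v0.
  by apply/eqP/rowP => u; rewrite mxE; apply/eqP; have := v0 u; rewrite negbK.
have [c0|c0] := leP c 0; first by apply: le_trans c0 _.
have [[p1 p2] /= Gp yp] : exists2 p : 'I_n * 'I_n, G p.1 p.2 & y p != 0.
  have : c * v 0 u != 0 by rewrite mulf_neq0 // gt_eqF.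
  rewrite eigen_edge_coord => s0.
  have [w Gw yw] : exists2 w, G u w & v 0 u + sg * v 0 w != 0.
    apply/exists_inP; apply: contraR s0; rewrite negb_exists_in => /forall_inP s0.
    by apply/eqP; rewrite big1 // => w /s0; rewrite negbK => /eqP.
  by exists (u, w).
pose q := [arg max_(p > (p1, p2) | G p.1 p.2) `|y p|]%O.
have [Gq qP] : G q.1 q.2 /\ forall p, G p.1 p.2 -> `|y p| <= `|y q|.
  by rewrite /q; case: Order.TotalTheory.arg_maxP.
have yq : 0 < `|y q| by apply: lt_le_trans (qP (p1, p2) Gp); rewrite normr_gt0.
have bound x : `|\sum_(w | G x w) (v 0 x + sg * v 0 w)| <= (degree G x)%:R * `|y q|.
  apply: le_trans (ler_norm_sum _ _ _) _; rewrite degreeE mulr_suml.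
  by apply: ler_sum => w Gw; rewrite mul1r; apply: (qP (x, w)).
have : `|c * y q| <= k%:R * `|y q|.
  have -> : c * y q = c * v 0 q.1 + sg * (c * v 0 q.2) by rewrite /y; ring.
  rewrite !eigen_edge_coord; apply: le_trans (ler_normD _ _) _.
  rewrite normrM normr_sg mul1r; apply: le_trans (lerD (bound _) (bound _)) _.
  by rewrite -mulrDl ler_wpM2r // -natrD ler_nat dk.
by rewrite normrM ler_pM2r // ger0_norm // ltW.
Qed.

End Eigenvalues.

Lemma eigenvalue_ge0 n (G : sgraph n) c : eigenvalue (L G) c -> 0 <= c.
Proof. by move=> /eigenvalueP[v vE v0]; apply: eigen_ge0 vE v0. Qed.

Lemma eigenvalue_le_edge_degrees n (G : sgraph n) k c :
  (forall x y, G x y -> (degree G x + degree G y <= k)%N) ->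
  eigenvalue (L G) c -> c <= k%:R.
Proof. by move=> dk /eigenvalueP[v vE v0]; exact: (eigen_le_edge_degrees vE dk v0). Qed.

Section EdgeDeletion.
Variables (n : nat) (G : sgraph n) (u v : 'I_n).

Definition edge_pair x y := ((x == u) && (y == v)) || ((x == v) && (y == u)).

Lemma del_edge_sym : symmetric (fun x y => G x y && ~~ edge_pair x y).
Proof.
by move=> x y; rewrite adj_sym /edge_pair; congr (_ && ~~ _);
  rewrite orbC [(x == v) && _]andbC [(x == u) && _]andbC.
Qed.

Lemma del_edge_irr : irreflexive (fun x y => G x y && ~~ edge_pair x y).
Proof. by move=> x; rewrite adj_irr. Qed.

Definition del_edge : sgraph n := SGraph del_edge_sym del_edge_irr.

Hypothesis Guv : G u v.

Lemma edge_neq : u != v.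
Proof. by apply: contraTneq Guv => ->; rewrite adj_irr. Qed.

Lemma del_edgeE x y : (G x y : nat) = (del_edge x y + edge_pair x y)%N.
Proof.
rewrite /=; have [|] := boolP (edge_pair x y); last by rewrite andbT addn0.
by move=> /orP[/andP[/eqP-> /eqP->]|/andP[/eqP-> /eqP->]]; rewrite ?[G v u]adj_sym Guv.
Qed.

Lemma degree_del_edge x : degree G x = (degree del_edge x + (x == u) + (x == v))%N.
Proof.
have dE (H : sgraph n) : degree H x = (\sum_y H x y)%N.
  by rewrite /degree -sum1dep_card big_mkcond; apply: eq_bigr => y _; case: (H x y).
rewrite !dE (eq_bigr _ (fun y _ => del_edgeE x y)) big_split /= -addnA; congr (_ + _)%N.
have sum_eq (c : bool) (z : 'I_n) : (\sum_y (c && (y == z) : nat) = c)%N.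
  by rewrite (bigD1 z) //= eqxx andbT big1 ?addn0 // => y /negPf ->; rewrite andbF.
rewrite (eq_bigr (fun y => (((x == u) && (y == v)) + ((x == v) && (y == u)))%N)).
  by rewrite big_split /= !sum_eq.
move=> y _; rewrite /edge_pair; have [xu|] := eqVneq x u => //=.
by rewrite xu (negPf edge_neq) /= orbF addn0.
Qed.

Definition edge_vec : 'rV[R]_n := delta_mx 0 u + sg *: delta_mx 0 v.

Lemma edge_vecE x : edge_vec 0 x = (x == u)%:R + sg * (x == v)%:R.
Proof. by rewrite !mxE eqxx. Qed.

Lemma signed_laplacian_del_edge : L G = L del_edge + edge_vec^T *m edge_vec.
Proof.
apply/matrixP => x y; rewrite [RHS]mxE !signed_laplacianE [(edge_vec^T *m edge_vec) x y]mxE big_ord1.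
rewrite [edge_vec^T _ _]mxE !edge_vecE degree_del_edge del_edgeE /edge_pair !natrD.
have uv := negPf edge_neq; have vu : (v == u) = false by rewrite eq_sym.
have s1 : sg * sg = 1 by rewrite -expr2.
have [->|xy] := eqVneq x y.
  rewrite !mulr1n; have [->|yu] := eqVneq y u; first by rewrite uv /=; ring.
  have [->|yv] := eqVneq y v; last by rewrite /=; ring.
  by rewrite /= !add0r !mulr1 s1; ring.
rewrite !mulr0n !add0r; have [xu|xu] := eqVneq x u; have [yv|yv] := eqVneq y v.
- by rewrite xu yv uv vu /=; ring.
- rewrite xu uv /= -xu [y == x]eq_sym (negPf xy) /=; ring.
- rewrite yv vu andbF /= -yv (negPf xy) /=; ring.
have [xv|xv] := eqVneq x v; have [yu|yu] := eqVneq y u; rewrite /=; ring.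
Qed.

Hypothesis bridge : ~~ connect del_edge u v.

Let alpha : R := (degree del_edge u + degree del_edge v)%:R.
Let beta : R := (degree del_edge u ^ 2 + degree del_edge u + degree del_edge v ^ 2 + degree del_edge v)%:R.

Lemma edge_vec_norm : edge_vec *m edge_vec^T = 2%:M.
Proof.
apply/matrixP => i j; rewrite !ord1 !mxE eqxx mulr1n.
have uv := negPf edge_neq.
rewrite (bigD1 u) //= (bigD1 v) /= 1?eq_sym ?edge_neq // big1 => [|w /andP[wu wv]].
  rewrite ![edge_vec^T _ _]mxE !edge_vecE !eqxx uv eq_sym uv.
  by transitivity (1 + sg ^+ 2); [rewrite /=; ring | rewrite sg1; ring].
by rewrite edge_vecE (negPf wu) (negPf wv) mulr0 addr0 mul0r.
Qed.

Lemma mul_edge_vecE m (M : 'M[R]_(n, m)) i w : (edge_vec *m M) i w = M u w + sg * M v w.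
Proof. by rewrite /edge_vec mulmxDl -scalemxAl -!rowE !mxE. Qed.

Lemma row_mul_edge_vec (x : 'rV[R]_n) : x *m edge_vec^T = (x 0 u + sg * x 0 v)%:M.
Proof.
rewrite -[LHS]trmxK trmx_mul trmxK; apply/matrixP => i j.
by rewrite !ord1 mxE mul_edge_vecE !mxE eqxx mulr1n.
Qed.

Lemma del_edge_uv : del_edge u v = false.
Proof. by apply: contraNF bridge => /connect1. Qed.

Lemma edge_vec_form : edge_vec *m L del_edge *m edge_vec^T = alpha%:M.
Proof.
rewrite row_mul_edge_vec; congr _%:M; rewrite !mul_edge_vecE !signed_laplacianE.
rewrite !eqxx !adj_irr [del_edge v u]adj_sym del_edge_uv (negPf edge_neq) eq_sym (negPf edge_neq).
transitivity ((degree del_edge u)%:R + sg ^+ 2 * (degree del_edge v)%:R).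
  by rewrite /=; ring.
by rewrite sg1 mul1r /alpha natrD.
Qed.

Lemma row_signed_laplacian_norm x :
  \sum_w L del_edge x w ^+ 2 = (degree del_edge x ^ 2 + degree del_edge x)%:R.
Proof.
under eq_bigr => w _ do rewrite signed_laplacianE.
rewrite (bigD1 x) //= eqxx adj_irr mulr0 addr0 mulr1n natrD natrX; congr (_ + _).
rewrite degreeE [RHS]big_mkcond [RHS](bigD1 x) //= adj_irr add0r.
apply: eq_bigr => w /negPf wx; rewrite eq_sym wx mulr0n add0r exprMn sg1 mul1r -natrX.
by case: (_ && _).
Qed.

(** Since [uv] was a bridge, [u] and [v] have no common neighbour; this is why the
    second moment of the edge does not depend on [sg] or on the rest of the graph. *)
Lemma rows_signed_laplacian_orth : \sum_w L del_edge u w * L del_edge v w = 0.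
Proof.
rewrite big1 // => w _; rewrite !signed_laplacianE.
have conn x y : del_edge x y -> connect del_edge x y by apply: connect1.
have csym : connect_sym del_edge by apply: sym_connect_sym; apply: adj_sym.
have [uw|uw] := eqVneq u w.
  by rewrite -uw [del_edge v u]adj_sym del_edge_uv eq_sym (negPf edge_neq) mulr0n mulr0 addr0 mulr0.
have [vw|vw] := eqVneq v w.
  by rewrite -vw del_edge_uv mulr0n mulr0 addr0 mul0r.
rewrite !mulr0n !add0r.
have [duw|duw] := boolP (del_edge u w); last by rewrite mulr0 mul0r.
have [dvw|dvw] := boolP (del_edge v w); last by rewrite mulr0 mulr0.
by case/negP: bridge; apply: connect_trans (conn _ _ duw) _; rewrite csym conn.
Qed.

Lemma edge_vec_form2 :
  edge_vec *m L del_edge *m L del_edge *m edge_vec^T = beta%:M.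
Proof.
pose y : 'rV[R]_n := edge_vec *m L del_edge.
have -> : edge_vec *m L del_edge *m L del_edge *m edge_vec^T = y *m y^T.
  by rewrite /y trmx_mul signed_laplacian_sym !mulmxA.
apply/matrixP => i j; rewrite !ord1 mxE [RHS]mxE eqxx mulr1n.
have yE w : y 0 w = L del_edge u w + sg * L del_edge v w.
  exact: mul_edge_vecE.
rewrite (eq_bigr (fun w => L del_edge u w ^+ 2 + L del_edge v w ^+ 2
    + 2 * sg * (L del_edge u w * L del_edge v w))); last first.
  move=> w _; rewrite [y^T _ _]mxE yE.
  transitivity (L del_edge u w ^+ 2 + sg ^+ 2 * L del_edge v w ^+ 2
    + 2 * sg * (L del_edge u w * L del_edge v w)); first by ring.
  by rewrite sg1 mul1r.
rewrite !big_split /= -mulr_sumr rows_signed_laplacian_orth mulr0 addr0.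
by rewrite !row_signed_laplacian_norm -natrD /beta addnA.
Qed.

Lemma del_edge_interlaced k :
  (forall x y, G x y -> (degree G x + degree G y <= k)%N) ->
  interlaced n (lambda (L G)) (lambda (L del_edge)) 0 k%:R.
Proof.
move=> dk; rewrite signed_laplacian_del_edge; apply: rank_one_interlaced.
- exact: signed_laplacian_sym.
- exact: eigenvalue_ge0.
- by rewrite -signed_laplacian_del_edge => c; apply: eigenvalue_le_edge_degrees.
Qed.

(** The moments do not depend on [sg], nor on the graph beyond the two degrees. *)
Lemma bridge_moments d e : degree G u = d -> degree G v = e ->
  moments n (lambda (L G)) (lambda (L del_edge))
    (d + e)%:R ((d ^ 2 + d + e ^ 2 + e)%:R - 4 / 3).
Proof.
move=> <- <-; have [g1 g2 g3] := rank_one_moments (signed_laplacian_sym del_edge)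
  edge_vec_norm edge_vec_form edge_vec_form2.
rewrite signed_laplacian_del_edge; split; rewrite ?g1 ?g2 ?g3 //;
  rewrite !degree_del_edge !eqxx (negPf edge_neq) eq_sym (negPf edge_neq);
  rewrite /alpha /beta ?natrD ?natrX /=; field; rewrite ?pnatr_eq0 //.
Qed.

End EdgeDeletion.

Definition ramp2_sum s n (G : sgraph n) : R := \sum_(i < n) ramp2 s (lambda (L G) i).

Lemma ramp2_sum_del_edge s n (G : sgraph n) u v :
  ramp2_sum s G = ramp2_sum s (del_edge G u v) +
    gain (ramp2 s) n (lambda (L G)) (lambda (L (del_edge G u v))).
Proof. by rewrite /gain sumrB addrC subrK. Qed.

End GraphMatrix.

(** * Disjoint unions *)

Section Splitting.

Lemma char_poly_mxsub (R : comNzRingType) m n (h : 'I_m -> 'I_n) (M : 'M[R]_n) :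
  bijective h -> char_poly (mxsub h h M) = char_poly M.
Proof.
move=> bij_h; have mn : m = n.
  by have := bij_eq_card bij_h; rewrite !card_ord.
subst m; have inj_h := bij_inj bij_h.
pose p := perm inj_h.
have -> : mxsub h h M = row_perm p (col_perm p M).
  by apply/matrixP => i j; rewrite !mxE !permE.
rewrite /char_poly /char_poly_mx.
have -> : 'X%:M - map_mx polyC (row_perm p (col_perm p M)) =
    row_perm p (col_perm p ('X%:M - map_mx polyC M)).
  apply/matrixP => i j; rewrite !mxE.
  by rewrite (inj_eq (@perm_inj _ p)).
rewrite row_permE col_permE !det_mulmx !det_perm odd_permV mulrC -mulrA.
by rewrite -signr_addb addbb expr0 mulr1.
Qed.

Section Glue.
Variables (a b n : nat) (f : 'I_a -> 'I_n) (g : 'I_b -> 'I_n).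

(** The concatenation of two parametrized sets of indices; when it is a bijection
    it renumbers [n] indices so that a matrix becomes block diagonal. *)
Definition glue (k : 'I_(a + b)) : 'I_n :=
  match fintype.split k with inl i => f i | inr j => g j end.

Lemma glue_lshift i : glue (lshift b i) = f i.
Proof. by rewrite /glue (unsplitK (inl i : 'I_a + 'I_b)). Qed.

Lemma glue_rshift j : glue (rshift a j) = g j.
Proof. by rewrite /glue (unsplitK (inr j : 'I_a + 'I_b)). Qed.

Hypotheses (fI : injective f) (gI : injective g) (abn : (a + b = n)%N).
Hypothesis fg : forall i j, f i != g j.

Lemma glue_bij : bijective glue.
Proof.
apply: inj_card_bij; last by rewrite !card_ord abn.
move=> k l; rewrite -(fintype.splitK k) -(fintype.splitK l).
case: (fintype.split k) => i; case: (fintype.split l) => j /=;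
  rewrite ?glue_lshift ?glue_rshift.
- by move/fI ->.
- by move/eqP; rewrite (negPf (fg _ _)).
- by move/eqP; rewrite eq_sym (negPf (fg _ _)).
- by move/gI ->.
Qed.

Lemma glue_cover x : (x \in codom f) || (x \in codom g).
Proof.
have [h' _ hK] := glue_bij; rewrite -(hK x) -(fintype.splitK (h' x)).
case: (fintype.split _) => i /=; first by rewrite glue_lshift codom_f.
by rewrite glue_rshift codom_f orbT.
Qed.

Lemma char_poly_split (R : comNzRingType) (M : 'M[R]_n) :
  (forall i j, M (f i) (g j) = 0) -> (forall i j, M (g j) (f i) = 0) ->
  char_poly M = char_poly (mxsub f f M) * char_poly (mxsub g g M).
Proof.
move=> M0 M0'; rewrite -(char_poly_mxsub M glue_bij).
have -> : mxsub glue glue M = block_mx (mxsub f f M) 0 0 (mxsub g g M).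
  apply/matrixP => k l; rewrite -(fintype.splitK k) -(fintype.splitK l) mxE.
  by case: (fintype.split k) => i; case: (fintype.split l) => j /=;
    rewrite ?glue_lshift ?glue_rshift ?block_mxEul ?block_mxEur ?block_mxEdl ?block_mxEdr !mxE.
by rewrite /char_poly char_block_diag_mx det_ublock.
Qed.

End Glue.

End Splitting.

Section GraphSplitting.
Variables (R : realType) (sg : R).
Local Notation L := (signed_laplacian sg).

Lemma sum_lambda_split (F : R -> R) n a b (M : 'M[R]_n) (A : 'M[R]_a) (B : 'M[R]_b) :
  M^T = M -> A^T = A -> B^T = B -> char_poly M = char_poly A * char_poly B ->
  \sum_(i < n) F (lambda M i) = \sum_(i < a) F (lambda A i) + \sum_(i < b) F (lambda B i).
Proof.
move=> Ms As Bs cE.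
have [P [d MPd]] := symmetric_diagonalized Ms.
have [PA [dA APd]] := symmetric_diagonalized As.
have [PB [dB BPd]] := symmetric_diagonalized Bs.
rewrite (sum_lambda F MPd) (sum_lambda F APd) (sum_lambda F BPd).
have sumE k (e : 'rV[R]_k) : \sum_i F (e 0 i) = \sum_(x <- codom (e 0)) F x.
  by rewrite codomE big_map big_enum.
rewrite !sumE -big_cat; apply: perm_big.
apply: prod_XsubC_eq; rewrite big_cat /= -(char_poly_diagonalized MPd).
by rewrite -(char_poly_diagonalized APd) -(char_poly_diagonalized BPd).
Qed.

Lemma signed_laplacian_mxsub n a (G : sgraph n) (H : sgraph a) (f : 'I_a -> 'I_n) :
  injective f -> (forall i j, G (f i) (f j) = H i j) ->
  (forall i x, G (f i) x -> x \in codom f) -> mxsub f f (L G) = L H.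
Proof.
move=> fI fGH f_closed; apply/matrixP => i j; rewrite mxE !signed_laplacianE fGH (inj_eq fI).
suff -> : degree G (f j) = degree H j by [].
rewrite /degree -(card_imset _ fI); apply: eq_card => x; rewrite !inE.
apply/idP/imsetP => [Gx|[k]]; last by rewrite inE => Hjk ->; rewrite fGH.
have /codomP[k xk] := f_closed _ _ Gx; exists k => //.
by rewrite inE -fGH -xk.
Qed.

Lemma ramp2_sum_split s n a b (G : sgraph n) (H : sgraph a) (K : sgraph b)
    (f : 'I_a -> 'I_n) (g : 'I_b -> 'I_n) :
  injective f -> injective g -> (a + b = n)%N -> (forall i j, f i != g j) ->
  (forall i j, G (f i) (f j) = H i j) -> (forall i j, G (g i) (g j) = K i j) ->
  (forall i j, ~~ G (f i) (g j)) ->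
  ramp2_sum sg s G = ramp2_sum sg s H + ramp2_sum sg s K.
Proof.
move=> fI gI abn fg fGH gGK fgN.
have cover := glue_cover fI gI abn fg.
have LH : mxsub f f (L G) = L H.
  apply: signed_laplacian_mxsub => // i x Gx; have := cover x.
  by case/orP => // /codomP[j xj]; rewrite xj (negPf (fgN _ _)) in Gx.
have LK : mxsub g g (L G) = L K.
  apply: signed_laplacian_mxsub => // i x Gx; have := cover x.
  by case/orP => // /codomP[j xj]; rewrite xj adj_sym (negPf (fgN _ _)) in Gx.
apply: sum_lambda_split; try exact: signed_laplacian_sym.
rewrite -LH -LK; apply: char_poly_split => // i j; rewrite signed_laplacianE.
  by rewrite (negPf (fg _ _)) (negPf (fgN _ _)) mulr0n mulr0 addr0.
by rewrite eq_sym (negPf (fg _ _)) adj_sym (negPf (fgN _ _)) mulr0n mulr0 addr0.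
Qed.

Lemma ramp2_sum_iso s n (G H : sgraph n) (f : 'I_n -> 'I_n) :
  injective f -> (forall i j, G (f i) (f j) = H i j) ->
  ramp2_sum sg s G = ramp2_sum sg s H.
Proof.
move=> fI fGH; have f_bij : bijective f by apply: injF_bij.
have LH : mxsub f f (L G) = L H.
  apply: signed_laplacian_mxsub => // i x _.
  by have [f' _ fK] := f_bij; rewrite -(fK x) codom_f.
rewrite /ramp2_sum /lambda; have -> // : spectrum (L G) = spectrum (L H).
by rewrite /spectrum -LH char_poly_mxsub.
Qed.

End GraphSplitting.

(** * Connectivity after the deletion of an edge *)

Section Connectivity.

Lemma connect_stable (T : finType) (e : rel T) (A : T -> Prop) x y :
  (forall z w, A z -> e z w -> A w) -> connect e x y -> A x -> A y.
Proof.
move=> Ae /connectP[p]; elim: p x => [|z p IH] x /=; first by move=> _ ->.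
by move=> /andP[xz zp] yE Ax; apply: (IH z zp yE); apply: Ae Ax xz.
Qed.

Variable n : nat.

Lemma sgraph_connect_sym (G : sgraph n) : connect_sym G.
Proof. exact/sym_connect_sym/adj_sym. Qed.

Lemma del_edge_reach (G : sgraph n) u v x : connected_graph G -> G u v ->
  connect (del_edge G u v) u x \/ connect (del_edge G u v) v x.
Proof.
move=> Gc Guv; set D := del_edge G u v.
pose A y := connect D u y \/ connect D v y.
apply: (@connect_stable _ G A u x) => //; last by left; apply: connect0.
move=> z w Az zw; have [/orP[/andP[_ /eqP ->]|/andP[_ /eqP ->]]|ne] := boolP (edge_pair u v z w).
- by right; apply: connect0.
- by left; apply: connect0.
have Dzw : connect D z w by apply: connect1; rewrite /D /= zw.
by case: Az => H; [left | right]; apply: connect_trans H Dzw.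
Qed.

Lemma del_edge_connected (G : sgraph n) u v : connected_graph G -> G u v ->
  connect (del_edge G u v) u v -> connected_graph (del_edge G u v).
Proof.
move=> Gc Guv uv x y.
have ux z : connect (del_edge G u v) u z.
  by have [//|] := del_edge_reach z Gc Guv; apply: connect_trans.
by apply: connect_trans (ux y); rewrite sgraph_connect_sym.
Qed.

Section Induced.
Variables (G : sgraph n) (A : {set 'I_n}).

Definition induced_adj : rel 'I_#|A| := fun i j => G (enum_val i) (enum_val j).

Lemma induced_adj_sym : symmetric induced_adj.
Proof. by move=> i j; apply: adj_sym. Qed.

Lemma induced_adj_irr : irreflexive induced_adj.
Proof. by move=> i; apply: adj_irr. Qed.

Definition induced_subgraph : sgraph #|A| := SGraph induced_adj_sym induced_adj_irr.

Lemma induced_connected : (forall x y, x \in A -> G x y -> y \in A) ->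
  (forall x y, x \in A -> y \in A -> connect G x y) -> connected_graph induced_subgraph.
Proof.
move=> Acl Aconn i j.
pose B y := exists2 k : 'I_#|A|, enum_val k = y & connect induced_subgraph i k.
suff [k /enum_val_inj <-] : B (enum_val j) by [].
apply: (@connect_stable _ G B (enum_val i)).
- move=> z w [k kz ik] zw.
  have wA : w \in A by apply: Acl zw; rewrite -kz enum_valP.
  exists (enum_rank_in wA w); first by rewrite enum_rankK_in.
  apply: connect_trans ik _; apply: connect1.
  by rewrite /= /induced_adj enum_rankK_in // kz.
- by apply: Aconn; apply: enum_valP.
- by exists i => //; apply: connect0.
Qed.

End Induced.

End Connectivity.

(** * Cutting a path *)

Section PathGraph.

Lemma card_le1_of n (A : {set 'I_n}) : (forall x y, x \in A -> y \in A -> x = y :> nat) -> (#|A| <= 1)%N.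
Proof. by move=> H; apply/card_le1_eqP => x y xA yA; apply/val_inj/H. Qed.

Lemma degree_path_graph n (u : 'I_n) : (degree (path_graph n) u <= 2)%N.
Proof.
pose A := [set v : 'I_n | u.+1 == v :> nat]; pose B := [set v : 'I_n | v.+1 == u :> nat].
apply: leq_trans (_ : #|A :|: B| <= 2)%N.
  by apply/subset_leq_card/fintype.subsetP => v; rewrite !inE.
apply: leq_trans (leq_card_setU A B) _; rewrite -[2%N]/(1 + 1)%N leq_add //.
  by apply: card_le1_of => x y; rewrite !inE => /eqP <- /eqP.
by apply: card_le1_of => x y; rewrite !inE => /eqP <- /eqP [].
Qed.

Section Cut.
Variables a b : nat.
Let G := path_graph (a.+1 + b.+1).
Let u : 'I_(a.+1 + b.+1) := lshift b.+1 ord_max.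
Let v : 'I_(a.+1 + b.+1) := rshift a.+1 ord0.
Let D := del_edge G u v.

Lemma path_cut_edge : G u v.
Proof. by rewrite /= /path_adj /= addn0 eqxx. Qed.

Lemma path_cut_lr i j : ~~ D (lshift b.+1 i) (rshift a.+1 j).
Proof.
apply/negP => /= /andP[]; rewrite /path_adj /edge_pair /= => e /negP; apply.
have := ltn_ord i; have := ltn_ord j => ltj lti.
have [ia j0] : (i = a :> nat) /\ (j = 0 :> nat)%N by move: e => /orP[/eqP|/eqP]; lia.
by apply/orP; left; apply/andP; split; apply/eqP/val_inj; rewrite /= ?ia ?j0.
Qed.

Lemma path_cut_ll i j : D (lshift b.+1 i) (lshift b.+1 j) = path_graph a.+1 i j.
Proof.
rewrite /= /path_adj /edge_pair /= -!val_eqE /=.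
have := ltn_ord i; have := ltn_ord j => ltj lti.
by rewrite [X in _ && ~~ X](_ : _ = false) ?andbT //; apply/negP; lia.
Qed.

Lemma path_cut_rr i j : D (rshift a.+1 i) (rshift a.+1 j) = path_graph b.+1 i j.
Proof.
rewrite /= /path_adj /edge_pair /= -!val_eqE /=.
have := ltn_ord i; have := ltn_ord j => ltj lti.
rewrite [X in _ && ~~ X](_ : _ = false) ?andbT; last by apply/negP; lia.
by apply/idP/idP; lia.
Qed.

Lemma path_cut_bridge : ~~ connect D u v.
Proof.
apply/negP => uv; suff : (v < a.+1)%N by rewrite /= addn0 ltnn.
apply: (@connect_stable _ D (fun x => x < a.+1)%N u v) => // z w za zw.
rewrite ltnNge; apply/negP => aw.
have wb : (w - a.+1 < b.+1)%N by have := ltn_ord w; lia.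
case/negP: (path_cut_lr (Ordinal za) (Ordinal wb)).
have -> : lshift b.+1 (Ordinal za) = z by apply: val_inj.
by have -> : rshift a.+1 (Ordinal wb) = w by apply: val_inj; rewrite /= subnKC.
Qed.

(** All degrees of a path are at most [2], so its eigenvalues are at most [4] and
    the first moment of every edge is at most [4]. *)
Lemma ramp2_sum_path_cut (R : realType) (sg s : R) : sg ^+ 2 = 1 ->
  ramp2_sum sg s G <=
  ramp2_sum sg s (path_graph a.+1) + ramp2_sum sg s (path_graph b.+1) + threshold s.
Proof.
move=> sg1; rewrite (ramp2_sum_del_edge sg s G u v) lerD //.
  rewrite (@ramp2_sum_split _ sg s _ _ _ D (path_graph a.+1) (path_graph b.+1)
    (@lshift a.+1 b.+1) (@rshift a.+1 b.+1)) //.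
  - exact: lshift_inj.
  - exact: rshift_inj.
  - by move=> i j; rewrite eq_lrshift.
  - exact: path_cut_ll.
  - exact: path_cut_rr.
  - exact: path_cut_lr.
have mom := bridge_moments sg1 path_cut_edge path_cut_bridge erefl erefl.
apply: (gain_le_threshold s _ mom).
  apply: del_edge_interlaced => //; first exact: path_cut_edge.
  by move=> x y _; rewrite -[4%N]/(2 + 2)%N leq_add // degree_path_graph.
by rewrite ler_nat -[4%N]/(2 + 2)%N leq_add // degree_path_graph.
Qed.

End Cut.
End PathGraph.

(** * Bridges that beat the threshold *)

Lemma degree_gt0 n (G : sgraph n) x y : G x y -> (0 < degree G x)%N.
Proof. by move=> Gxy; apply/card_gt0P; exists y; rewrite inE. Qed.

Lemma degree_le_order n (G : sgraph n) x : (degree G x <= n)%N.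
Proof. by rewrite -[X in (_ <= X)%N]card_ord; apply: max_card. Qed.

Section BridgeGain.
Variables (R : realType) (sg : R).
Hypothesis sg1 : sg ^+ 2 = 1.
Variables (n : nat) (G : sgraph n) (u v : 'I_n).
Hypotheses (Guv : G u v) (bridge : ~~ connect (del_edge G u v) u v).
Local Notation L := (signed_laplacian sg).
Local Notation edge_gain s := (gain (ramp2 s) n (lambda (L G)) (lambda (L (del_edge G u v)))).

Lemma bridge_gain_dense s : (6 <= degree G u + degree G v)%N -> threshold s <= edge_gain s.
Proof.
move=> de; have deg_le := degree_le_order G.
apply: (gain_ge_threshold_mean6 (U := (n + n)%:R)) (bridge_moments sg1 Guv bridge erefl erefl) _.
- by apply: del_edge_interlaced => // x y _; apply: leq_add.
- by rewrite ler_nat; have := deg_le u; have := deg_le v; lia.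
- by rewrite ler_nat.
Qed.

Lemma bridge_gain_five s : (degree G u + degree G v = 5)%N ->
  (forall x y, G x y -> (degree G x + degree G y <= 5)%N) -> threshold s <= edge_gain s.
Proof.
move=> de le5; apply: gain_ge_threshold_mean5 (bridge_moments sg1 Guv bridge erefl erefl) _ _.
- exact: (del_edge_interlaced sg1 Guv).
- by rewrite de.
have : (18 <= degree G u ^ 2 + degree G u + degree G v ^ 2 + degree G v)%N.
  have := degree_gt0 Guv; have := @degree_gt0 _ G v u; rewrite adj_sym => /(_ Guv).
  move: (degree G u) (degree G v) de => d e de.
  have -> : e = (5 - d)%N by rewrite -de addKn.
  have : (d <= 5)%N by rewrite -de leq_addr.
  by clear de; case: d => [|[|[|[|[|[|d]]]]]].
by rewrite -(ler_nat R); lra.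
Qed.

Lemma bridge_gain_claw s : degree G u = 3%N -> degree G v = 1%N ->
  (forall x y, G x y -> (degree G x + degree G y <= 4)%N) -> threshold s <= edge_gain s.
Proof.
move=> du dv le4; apply: gain_ge_threshold_claw.
  exact: (del_edge_interlaced sg1 Guv).
have := bridge_moments sg1 Guv bridge du dv.
by rewrite (_ : (3 + 1)%:R = 4) // (_ : _ - _ = 38 / 3 :> R) //; field.
Qed.

End BridgeGain.

(** * Connected graphs with small degrees and no cycle are paths *)

Section PathRecognition.
Variables (n : nat) (G : sgraph n).
Hypothesis Gconn : connected_graph G.
Hypothesis Gbridge : forall x y, G x y -> ~~ connect (del_edge G x y) x y.
Hypothesis Gdeg : forall x, (degree G x <= 2)%N.

Definition is_trail (s : seq 'I_n) := uniq s && sorted G s.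

Lemma degree_ge3 x y z w : G x y -> G x z -> G x w -> y != z -> y != w -> z != w ->
  (2 < degree G x)%N.
Proof.
move=> Gy Gz Gw yz yw zw.
have <- : #|[:: y; z; w]| = 3%N.
  by apply/eqP; rewrite (card_uniqP _) //= !inE negb_or yz yw zw.
by apply/subset_leq_card/fintype.subsetP => a; rewrite !inE => /or3P[] /eqP ->.
Qed.

(** Take a longest trail.  If it missed a vertex, some edge would leave it: at an
    end of the trail this gives a longer trail, at an inner vertex a third
    neighbour. *)
Lemma trail_spanning : exists2 s, is_trail s & forall x, x \in s.
Proof.
pose P k := `[< exists2 s, is_trail s & size s = k >].
have P0 : exists k, P k by exists 0%N; apply/asboolP; exists [::].
have Pmax k : P k -> (k <= n)%N.
  move=> /asboolP[s /andP[us _] <-].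
  by rewrite -[X in (_ <= X)%N]card_ord -(card_uniqP us) max_card.
case: (ex_maxnP P0 Pmax) => k /asboolP[s st sk] kmax.
exists s => //; case: (posnP k) => [k0|k_gt0].
  move=> x; have /kmax : P 1%N by apply/asboolP; exists [:: x].
  by rewrite k0.
have longer t : is_trail t -> (size t <= size s)%N.
  by move=> tt; rewrite sk; apply: kmax; apply/asboolP; exists t.
case: s st sk longer => [|h t] st sk longer; first by rewrite -sk in k_gt0.
have [uht pht] : uniq (h :: t) /\ path G h t by case/andP: st.
move=> x; apply: (@connect_stable _ G (fun x => x \in h :: t) h x) => //; last first.
  by rewrite mem_head.
move=> z w zin zw; apply: contraT => wNin.
have [z_h|z_h] := eqVneq z h.
  have /longer : is_trail (w :: h :: t).
    by apply/andP; split; [rewrite cons_uniq wNin | rewrite /= -z_h adj_sym zw z_h].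
  by rewrite ltnn.
have [z_l|z_l] := eqVneq z (last h t).
  have /longer : is_trail (rcons (h :: t) w).
    apply/andP; split; first by rewrite rcons_uniq wNin.
    by rewrite /= rcons_path pht -z_l.
  by rewrite size_rcons ltnn.
have zt : z \in t by move: zin; rewrite inE (negPf z_h).
case/splitPr: zt z_l uht pht wNin {st sk longer zin} => p1 p2.
case: p2 => [|y p2]; first by rewrite last_cat /= eqxx.
move=> _ uht; rewrite cat_path /= => /and4P[_ xz zy _] wNin.
have := Gdeg z; rewrite leqNgt => /negP[].
apply: (@degree_ge3 z (last h p1) y w) => //; first by rewrite adj_sym.
- apply: contraTneq uht => e; rewrite -cat_cons cat_uniq.
  apply/negP => /and3P[_ /hasPn H _].
  have /H : y \in z :: y :: p2 by rewrite !inE eqxx orbT.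
  by rewrite /= -e mem_last.
- apply: contraNneq wNin => <-; rewrite -cat_cons mem_cat mem_last //.
- by apply: contraNneq wNin => <-; rewrite !(inE, mem_cat) eqxx !orbT.
Qed.

(** Two vertices of the spanning trail that are adjacent but not consecutive would
    be joined by an edge and by a piece of the trail, so that the edge would not be
    a bridge. *)
Lemma iso_path_graph : exists2 f : 'I_n -> 'I_n,
  injective f & forall i j, G (f i) (f j) = path_graph n i j.
Proof.
have [s /andP[us ss] s_all] := trail_spanning.
have sn : size s = n.
  by rewrite -(card_uniqP us) -[RHS]card_ord; apply: eq_card => x; rewrite s_all.
have [n0|n_gt0] := posnP n.
  by exists id => // i; have := ltn_ord i; rewrite {2}n0.
pose x0 : 'I_n := Ordinal n_gt0.
pose f (i : 'I_n) := nth x0 s i.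
have fI : injective f.
  by move=> i j /eqP; rewrite /f nth_uniq ?sn // => /eqP/val_inj.
have step k : (k.+1 < n)%N -> G (nth x0 s k) (nth x0 s k.+1).
  move=> kn; move: ss sn; case: (s) => [_ n0|h t /= /(path.pathP x0) H st].
    by rewrite -n0 in kn.
  by apply: H; rewrite -ltnS st.
have G_lt (i j : 'I_n) : (i < j)%N -> G (f i) (f j) -> (i.+1 == j :> nat).
  move=> ij Gij; apply: contraT => ij1.
  case/negP: (Gbridge Gij).
  suff conn m : (i + m <= j)%N -> connect (del_edge G (f i) (f j)) (f i) (nth x0 s (i + m)).
    by have := conn (j - i)%N; rewrite subnKC ?(ltnW ij) //; apply.
  elim: m => [|m IH] ltj; first by rewrite addn0 connect0.
  rewrite addnS; apply: connect_trans (IH _) (connect1 _); first by lia.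
  have jn := ltn_ord j.
  rewrite /= step /edge_pair; last by lia.
  rewrite /f !nth_uniq ?sn //; lia.
exists f => // i j; apply/idP/idP.
  case: (ltngtP i j) => [ij|ji|/val_inj ->]; rewrite /= /path_adj.
  - by move=> /(G_lt i j ij) ->.
  - by rewrite adj_sym => /(G_lt j i ji) ->; rewrite orbT.
  - by rewrite adj_irr.
rewrite /= /path_adj => /orP[] /eqP e.
  by rewrite /f -e step // e.
by rewrite adj_sym /f -e step // e.
Qed.

End PathRecognition.

(** * The path is minimal *)

Section Minimum.
Variables (R : realType) (sg : R).
Hypothesis sg1 : sg ^+ 2 = 1.

Definition edges n (G : sgraph n) := [set p : 'I_n * 'I_n | G p.1 p.2].

Lemma card_edges_del n (G : sgraph n) u v : G u v ->
  (#|edges (del_edge G u v)| < #|edges G|)%N.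
Proof.
move=> Guv; apply: proper_card; apply/properP; split.
  by apply/fintype.subsetP => p; rewrite !inE /= => /andP[].
by exists (u, v); rewrite !inE /= ?Guv // /edge_pair !eqxx.
Qed.

Lemma ramp2_sum_bridge s n (G : sgraph n) u v : connected_graph G -> G u v ->
  ~~ connect (del_edge G u v) u v ->
  threshold s <= gain (ramp2 s) n (lambda (signed_laplacian sg G)) (lambda (signed_laplacian sg (del_edge G u v))) ->
  (forall m (H : sgraph m), (m < n)%N -> connected_graph H ->
     ramp2_sum sg s (path_graph m) <= ramp2_sum sg s H) ->
  ramp2_sum sg s (path_graph n) <= ramp2_sum sg s G.
Proof.
move=> Gc Guv bridge le_gain IH; set D := del_edge G u v in le_gain bridge *.
pose A := [set x | connect D u x].
have csym := sgraph_connect_sym D.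
have uA : u \in A by rewrite inE connect0.
have vA : v \notin A by rewrite inE.
have cardA : (#|A| + #|~: A| = n)%N by rewrite cardsC card_ord.
have A_gt0 : (0 < #|A|)%N by apply/card_gt0P; exists u.
have B_gt0 : (0 < #|~: A|)%N by apply/card_gt0P; exists v; rewrite inE.
have Aconn : connected_graph (induced_subgraph D A).
  apply: induced_connected => x y; rewrite !inE.
    by move=> ux xy; apply: connect_trans ux (connect1 xy).
  by move=> ux uy; apply: connect_trans uy; rewrite csym.
have Bconn : connected_graph (induced_subgraph D (~: A)).
  apply: induced_connected => x y; rewrite !inE.
    move=> ux xy; apply: contra ux => uy; apply: connect_trans uy _.
    by apply: connect1; rewrite adj_sym.
  have vx z : ~~ connect D u z -> connect D v z.
    by have [->|] := del_edge_reach z Gc Guv.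
  by move=> /vx vx_ /vx; apply: connect_trans; rewrite csym.
rewrite (ramp2_sum_del_edge sg s G u v) -/D.
rewrite (@ramp2_sum_split _ sg s _ _ _ D (induced_subgraph D A) (induced_subgraph D (~: A))
  enum_val enum_val) //.
- have pE m : m = n -> ramp2_sum sg s (path_graph n) = ramp2_sum sg s (path_graph m).
    by move=> ->.
  have cE : (#|A|.-1.+1 + #|~: A|.-1.+1)%N = n by rewrite !prednK.
  rewrite (pE _ cE).
  apply: le_trans (ramp2_sum_path_cut _ _ s sg1) _; rewrite !prednK //.
  have ltA : (#|A| < n)%N by apply: leq_trans (eq_leq cardA); rewrite -addn1 leq_add2l.
  have ltB : (#|~: A| < n)%N by apply: leq_trans (eq_leq cardA); rewrite -add1n leq_add2r.
  exact: lerD (lerD (IH _ _ ltA Aconn) (IH _ _ ltB Bconn)) le_gain.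
- exact: enum_val_inj.
- exact: enum_val_inj.
- move=> i j; apply: contraTneq (enum_valP i) => ->.
  by have := enum_valP j; rewrite inE.
- move=> i j; apply/negP => Dij; have := enum_valP j; rewrite inE; case/negP.
  have := enum_valP i; rewrite inE => ui; rewrite inE.
  by apply: connect_trans ui (connect1 Dij).
Qed.

(** Induction on the number of vertices and then on the number of edges.  The
    bridge to delete is one whose degree sum is at least [6], or else equal to
    [5], or else any edge at a vertex of degree at least [3]; its degrees are
    then [3] and [1]. *)
Lemma ramp2_sum_path_min s n (G : sgraph n) : connected_graph G ->
  ramp2_sum sg s (path_graph n) <= ramp2_sum sg s G.
Proof.
elim/ltn_ind: n G => n IHn G.
have [k] := ubnP #|edges G|; elim: k G => [|k IHk] G; first by rewrite ltn0.
rewrite ltnS => leGk Gc.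
have [[u [v [Guv uv]]]|no_cycle] :=
    pselect (exists u v, G u v /\ connect (del_edge G u v) u v).
  have lt_card := card_edges_del Guv.
  apply: le_trans (IHk (del_edge G u v) _ (del_edge_connected Gc Guv uv)) _.
    exact: leq_trans lt_card leGk.
  rewrite (ramp2_sum_del_edge sg s G u v) lerDl.
  apply: (@gain_ge0 _ _ _ _ 0 (n + n)%:R).
  apply: del_edge_interlaced => // x y _.
  by apply: leq_add; apply: degree_le_order.
have bridge x y : G x y -> ~~ connect (del_edge G x y) x y.
  by move=> Gxy; apply/negP => xy; apply: no_cycle; exists x, y.
have step u v : G u v -> threshold s <= gain (ramp2 s) n (lambda (signed_laplacian sg G))
    (lambda (signed_laplacian sg (del_edge G u v))) ->
    ramp2_sum sg s (path_graph n) <= ramp2_sum sg s G.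
  move=> Guv le_gain; apply: (ramp2_sum_bridge Gc Guv (bridge _ _ Guv) le_gain) => m H ltmn.
  exact: IHn.
have [[u [v [Guv d6]]]|lt6] :=
    pselect (exists u v, G u v /\ (6 <= degree G u + degree G v)%N).
  by apply: (step u v Guv); apply: bridge_gain_dense => //; apply: bridge.
have le5 x y : G x y -> (degree G x + degree G y <= 5)%N.
  by move=> Gxy; rewrite leqNgt; apply/negP => d6; apply: lt6; exists x, y.
have [[u [v [Guv d5]]]|ne5] :=
    pselect (exists u v, G u v /\ (degree G u + degree G v = 5)%N).
  by apply: (step u v Guv); apply: bridge_gain_five => //; apply: bridge.
have le4 x y : G x y -> (degree G x + degree G y <= 4)%N.
  move=> Gxy; have := le5 x y Gxy; rewrite leq_eqVlt => /predU1P[d5|//].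
  by case: ne5; exists x, y.
have [[u du]|deg2] := pselect (exists u, 3 <= degree G u)%N.
  have [v] : exists v, v \in [set v | G u v] by apply/card_gt0P; apply: leq_trans du.
  rewrite inE => Guv; have := le4 u v Guv; have := @degree_gt0 _ G v u.
  rewrite adj_sym => /(_ Guv) dv duv.
  by apply: (step u v Guv); apply: bridge_gain_claw => //; [apply: bridge | lia | lia].
have [x|f fI fG] := iso_path_graph Gc bridge.
  by rewrite leqNgt; apply/negP => dx; apply: deg2; exists x.
by rewrite (ramp2_sum_iso sg s fI fG).
Qed.

Lemma sum_lambda_path_min (F : R -> R) n (G : sgraph n) :
  connected_graph G -> admissible F ->
  \sum_(i < n) F (lambda (signed_laplacian sg (path_graph n)) i)
    <= \sum_(i < n) F (lambda (signed_laplacian sg G) i).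
Proof.
move=> Gc Fadm.
have ge0 (H : sgraph n) (i : 'I_n) : 0 <= lambda (signed_laplacian sg H) i.
  by apply: (eigenvalue_ge0 sg1 (G := H)); apply: lambda_eigenvalue; first exact: signed_laplacian_sym.
apply: (admissible_sum_le Fadm (ge0 G) (ge0 (path_graph n))) => s.
exact: ramp2_sum_path_min.
Qed.

End Minimum.

Theorem theorem3p7 (R : realType) (n : nat) (G : sgraph n)
    (Gconn : connected_graph G) (F : R -> R) (Fadm : admissible F) :
  \sum_(i < n) F (lambda (laplacian R (path_graph n)) i)
    <= \sum_(i < n) F (lambda (laplacian R G) i)
  /\
  \sum_(i < n) F (lambda (signless_laplacian R (path_graph n)) i)
    <= \sum_(i < n) F (lambda (signless_laplacian R G) i).
Proof.
have LE (H : sgraph n) : laplacian R H = signed_laplacian (- 1) H.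
  by rewrite /signed_laplacian scaleN1r.
have QE (H : sgraph n) : signless_laplacian R H = signed_laplacian 1 H.
  by rewrite /signed_laplacian scale1r.
by split; rewrite ?LE ?QE; apply: sum_lambda_path_min => //; rewrite ?sqrrN expr1n.
Qed.
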